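(* Let $0<q<1\le p<\infty$. Let $\sigma$ and $\omega$ be locally finite Borel measures on $\mathbb{R}^d$, let $\lambda=\{\lambda_Q\}$ be a family of non-negative reals indexed by dyadic cubes, and let $\mathcal{Q}$ and $T_\lambda(\cdot\,\sigma)$ be the associated collection of cubes and the associated operator. Then the following assertions hold. (i) (Sufficiency) Every factorization $\lambda_Q=b_Qc_Q$ ($Q\in\mathcal{Q}$) with non-negative reals $\{b_Q\}_{Q\in\mathcal{Q}}$ and $\{c_Q\}_{Q\in\mathcal{Q}}$ satisfies the estimate $$\|T_\lambda(\cdot\,\sigma)\|_{L^p(\sigma)\to L^q(\omega)}\le C_{p,q}\Big(\int\big(\sup_{Q\in\mathcal{Q}}b_Q1_Q\big)^{\frac{q}{1-q}}\,\mathrm{d}\omega\Big)^{\frac{1-q}{q}}\Big(\int\Big(\sum_{Q\in\mathcal{Q}}c_Q\frac{\omega(Q)}{\sigma(Q)}1_Q\Big)^{p'}\,\mathrm{d}\sigma\Big)^{\frac{1}{p'}},$$ where $C_{p,q}$ depends only on $p$ and $q$. (ii) (Necessity) There exists a factorization $\lambda_Q=b_Qc_Q$ ($Q\in\mathcal{Q}$) with non-negative reals $\{b_Q\}_{Q\in\mathcal{Q}}$, $\{c_Q\}_{Q\in\mathcal{Q}}$ that satisfies the reverse estimate $$\Big(\int\big(\sup_{Q\in\mathcal{Q}}b_Q1_Q\big)^{\frac{q}{1-q}}\,\mathrm{d}\omega\Big)^{\frac{1-q}{q}}\Big(\int\Big(\sum_{Q\in\mathcal{Q}}c_Q\frac{\omega(Q)}{\sigma(Q)}1_Q\Big)^{p'}\,\mathrm{d}\sigma\Big)^{\frac{1}{p'}}\le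 C'_{p,q}\,\|T_\lambda(\cdot\,\sigma)\|_{L^p(\sigma)\to L^q(\omega)},$$ where $C'_{p,q}$ depends only on $p$ and $q$. In the endpoint case $p=1$ (so $p'=\infty$), the last factor $\big(\int(\cdots)^{p'}\,\mathrm{d}\sigma\big)^{1/p'}$ in both estimates is interpreted as $\big\|\sum_{Q\in\mathcal{Q}}c_Q\frac{\omega(Q)}{\sigma(Q)}1_Q\big\|_{L^\infty(\sigma)}$.
   Context: $\mathcal{D}$ is the collection of all dyadic cubes $2^k([0,1)^d+j)$, $k\in\mathbb{Z}$, $j\in\mathbb{Z}^d$, in $\mathbb{R}^d$. Given non-negative reals $\{\lambda_Q\}_{Q\in\mathcal{D}}$ and measures $\sigma,\omega$, set $\mathcal{Q}:=\{Q\in\mathcal{D}:\lambda_Q>0,\ \sigma(Q)>0,\ \omega(Q)>0\}$. The positive dyadic operator is $T_\lambda(f\sigma):=\sum_{Q\in\mathcal{Q}}\lambda_Q\big(\frac{1}{\sigma(Q)}\int_Q f\,\mathrm{d}\sigma\big)1_Q$. (Restricting the sum from $\mathcal{D}$ to $\mathcal{Q}$ does not affect the norm inequality below.) The norm $\|T_\lambda(\cdot\,\sigma)\|_{L^p(\sigma)\to L^q(\omega)}\in[0,\infty]$ is the least constant $C$ such that $\|T_\lambda(f\sigma)\|_{L^q(\omega)}\le C\|f\|_{L^p(\sigma)}$ for every $f\in L^p(\sigma)$; since $\lambda_Q\ge0$, this amounts to the inequality for non-negative $f$, for which $T_\lambda(f\sigma)$ is well defined with values in $[0,\infty]$. Here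 $\|g\|_{L^q(\omega)}:=(\int|g|^q\,\mathrm{d}\omega)^{1/q}$ also for $q<1$. $p'=\frac{p}{p-1}\in[1,\infty]$ is the Hölder conjugate. Quantities may take the value $\infty$. *)

(* Defs.v *)
From mathcomp Require Import all_boot all_order all_algebra.
From mathcomp Require Import all_classical all_reals all_analysis.

Set Implicit Arguments.
Unset Strict Implicit.
Unset Printing Implicit Defensive.

Import Order.TTheory GRing.Theory Num.Theory.
Import numFieldNormedType.Exports.

Local Open Scope classical_set_scope.
Local Open Scope ring_scope.
Local Open Scope ereal_scope.

(* R^d with its Borel sigma-algebra; the carrier is convertible to 'rV[R]_d. *)
Notation borelRd R d := (g_sigma_algebraType (@open 'rV[R]_d)).

Definition locally_finite (R : realType) (d : nat)
    (mu : {measure set (borelRd R d) -> \bar R}) : Prop :=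
  forall x : 'rV[R]_d, exists U : set 'rV[R]_d, open_nbhs x U /\ mu U < +oo.

Definition unit_cube (R : realType) (d : nat) : set 'rV[R]_d :=
  [set x | forall i : 'I_d, (0 <= x ord0 i < 1)%R].

Definition dyadic_cube (R : realType) (d : nat) (k : int) (j : 'rV[int]_d) :
    set 'rV[R]_d :=
  [set ((2 : R) ^ k *: (x + map_mx intr j))%R | x in @unit_cube R d].

Definition dyadic (R : realType) (d : nat) : set (set (borelRd R d)) :=
  [set Q | exists (k : int) (j : 'rV[int]_d), Q = @dyadic_cube R d k j].

Section Operator.
Context (R : realType) (d : nat).
Local Notation Rd := (borelRd R d).
Variables (sigma omega : {measure set Rd -> \bar R}).

(* A family indexed by dyadic cubes is a total function on [set Rd], of which
   only the values on dyadic cubes matter. *)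
Variable lambda : set Rd -> R.

Definition calQ : set (set Rd) :=
  [set Q | [/\ @dyadic R d Q, (0 < lambda Q)%R, 0 < sigma Q & 0 < omega Q]].

Definition Tlambda (f : Rd -> R) (x : Rd) : \bar R :=
  \esum_(Q in calQ)
    (lambda Q)%:E * ((sigma Q)^-1 * \int[sigma]_(y in Q) (f y)%:E)
    * (\1_Q x)%:E.

(* For signed f the sum defining [Tlambda f] need not make sense; since
   lambda is non-negative, the inequality is tested on f >= 0. *)
Definition Tlambda_norm (p q : R) : \bar R :=
  ereal_inf [set C | 0 <= C /\
    forall f : Rd -> R, f \in Lfun sigma p%:E -> (forall x, (0 <= f x)%R) ->
      'N[omega]_(q%:E)[Tlambda f] <= C * 'N[sigma]_(p%:E)[EFin \o f]].

Definition factorization (b c : set Rd -> R) : Prop :=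
  forall Q, calQ Q -> [/\ (0 <= b Q)%R, (0 <= c Q)%R & lambda Q = (b Q * c Q)%R].

(* The supremum is taken in [0, +oo], hence is 0 when [calQ] is empty,
   whereas [ereal_sup set0 = -oo]. *)
Definition sup_b (b : set Rd -> R) (x : Rd) : \bar R :=
  maxe 0 (ereal_sup [set (b Q * \1_Q x)%:E | Q in calQ]).

Definition sum_c (c : set Rd -> R) (x : Rd) : \bar R :=
  \esum_(Q in calQ) (c Q)%:E * (omega Q / sigma Q) * (\1_Q x)%:E.

(* [hoelder_conjugate 1%:E = +oo], for which ['N[sigma]_+oo] is the
   L^infinity(sigma)-norm. *)
Definition factor_bound (p q : R) (b c : set Rd -> R) : \bar R :=
  (\int[omega]_x (sup_b b x) `^ (q / (1 - q))) `^ ((1 - q) / q)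
  * 'N[sigma]_(hoelder_conjugate p%:E)[sum_c c].

End Operator.

(* Main.v *)
Require Import Defs.
From mathcomp Require Import all_boot all_order all_algebra.
From mathcomp Require Import all_classical all_reals all_analysis.
From mathcomp Require Import measurable_realfun ess_sup_inf.
From mathcomp Require Import ring lra.

(** Write <f>_Q for the mean of f over Q with respect to sigma, p' for the
    exponent conjugate to p, and r = q / (1 - q).

    Sufficiency is Hoelder's inequality twice, with constant 1. Pointwise,
    T f <= (sup_Q b_Q 1_Q) G with G = sum_Q c_Q <f>_Q 1_Q. Hoelder's inequality
    with exponents 1/(1-q) and 1/q (hoelder_lt1) bounds the L^q(omega)
    quasi-norm of this product by the L^r(omega) norm of the supremum times
    int G domega, and the latter integral equals
    int f (sum_Q c_Q omega(Q)/sigma(Q) 1_Q) dsigma.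

    Necessity is Maurey's factorization of a positive operator into L^q with
    q < 1: there is a weight w = u^(q-1), with int u^q domega <= N^q, for which
    int (T f) w domega <= 12 N^q whenever f is in the unit ball of L^p(sigma);
    here N is an admissible constant in the norm inequality. The function u is
    nearly a maximizer of the concave functional v |-> int v^q domega over the
    image of the unit ball, and the bound on int (T f) w is the optimality
    condition (approximate_maximizer). The factors are c_Q = lambda_Q m_Q and
    b_Q = 1 / m_Q, where m_Q is the mean of w over Q with respect to omega. By
    duality (Lnorm_duality) the bound on int (T f) w domega is the bound on
    sum_Q c_Q omega(Q)/sigma(Q) 1_Q in L^p'(sigma). By Jensen's inequality
    (jensen_powRN) b_Q is at most a power of the omega-mean of u^(q/2) over Q, so
    that sup_Q b_Q 1_Q is at most a power of a dyadic maximal function of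
    u^(q/2), and the L^2 bound of the latter (maximal_L2) gives the bound on the
    supremum in L^r(omega).

    The comparability of the competitors that the near maximizer relies on
    is available for finitely many cubes only. The factorization is therefore
    constructed for each member of an increasing sequence of finite families of
    cubes (finite_factorization). The resulting b_Q stay in a compact interval of
    ]0, +oo[ for each Q, so they accumulate along an ultrafilter
    (ultrafilter_selection), and both bounds pass to the limit by monotone
    convergence. *)

Set Implicit Arguments.
Unset Strict Implicit.
Unset Printing Implicit Defensive.

Import Order.TTheory GRing.Theory Num.Theory.
Import numFieldNormedType.Exports.

Local Open Scope classical_set_scope.
Local Open Scope ring_scope.

(** * Inequalities between real powers *)

Section RealInequalities.
Context {R : realType}.
Implicit Types (a b m q r t u v w x y : R).

Lemma powR_bernoulli q x : 0 < q -> q < 1 -> 0 <= x ->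
  x `^ q <= 1 + q * (x - 1).
Proof.
move=> q0 q1 x0.
have := @conjugate_powR R (x `^ q) 1 q^-1 (1 - q)^-1 (powR_ge0 _ _) ler01.
rewrite !invr_gt0 subr_gt0 !invrK subrKC => /(_ q0 q1 erefl).
rewrite mulr1 powR1 -powRrM mulfV ?gt_eqF// (powRr1 x0) => h.
by apply: (le_trans h); lra.
Qed.

(** Concavity of t |-> t^q: the graph lies below its tangent at a. *)
Lemma powR_tangent q a b : 0 < q -> q < 1 -> 0 < a -> 0 <= b ->
  b `^ q <= a `^ q + q * a `^ (q - 1) * (b - a).
Proof.
move=> q0 q1 a0 b0.
have ba0 : 0 <= b / a by rewrite divr_ge0// ltW.
have -> : b = (b / a) * a by rewrite divfK// gt_eqF.
rewrite powRM//; last exact: ltW.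
have aq0 : 0 < a `^ q by exact: powR_gt0.
have -> : a `^ (q - 1) = a `^ q / a.
  by rewrite powRB ?(gt_eqF a0) ?implybT// powRr1// ltW.
have := ler_wpM2r (ltW aq0) (powR_bernoulli q0 q1 ba0).
move/le_trans; apply; rewrite le_eqVlt; apply/orP; left; apply/eqP.
by field; rewrite gt_eqF.
Qed.

(** Convexity of t |-> t^(-r): the graph lies above its tangent at m. The terms
    are arranged so that every one of them is positive. *)
Lemma powRN_tangent r m t : 0 < r -> 0 < m -> 0 < t ->
  m `^ (- r) * (1 + r) <= t `^ (- r) + r * m `^ (- r) / m * t.
Proof.
move=> r0 m0 t0.
have -> : t `^ (- r) = m `^ (- r) * (t / m) `^ (- r).
  rewrite -powRM; [|exact: ltW|by rewrite divr_ge0// ltW].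
  by rewrite mulrC divfK// gt_eqF.
have tm0 : 0 < t / m by rewrite divr_gt0.
have h : 1 + r <= (t / m) `^ (- r) + r * (t / m).
  rewrite /powR gt_eqF//.
  have h1 := expR_ge1Dx (- r * ln (t / m)).
  have h2 : ln (t / m) <= t / m - 1.
    by have := @le_ln1Dx R (t / m - 1); rewrite subrKC; apply; lra.
  nra.
have := ler_wpM2l (powR_ge0 m (- r)) h.
move/le_trans; apply; rewrite le_eqVlt; apply/orP; left; apply/eqP.
by field; rewrite gt_eqF.
Qed.

Lemma powRN_le2 q u w : q < 1 -> 0 < q -> 0 < u -> u <= 2 * w ->
  w `^ (q - 1) <= 2 * u `^ (q - 1).
Proof.
move=> q1 q0 u0 uw.
have w0 : 0 < w by lra.
have -> : q - 1 = - (1 - q) by lra.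
rewrite !powRN ler_pdivlMr ?powR_gt0// mulrC ler_pdivrMr ?powR_gt0//.
rewrite -(@powRr1 R 2)//.
have := @ge0_ler_powR R (1 - q) _ u (2 * w).
rewrite !nnegrE => /(_ _ _ _ uw) h.
apply: (le_trans (h _ _ _)); [lra|lra|lra|].
rewrite powRM//; last exact: ltW.
rewrite ler_wpM2r ?powR_ge0// ler_powR//; lra.
Qed.

(** First variation of t |-> t^q when u is moved a proportion e of the way
    towards v. The tangent at the perturbed point w = (1 - e) u + e v gives the
    inequality with w^(q-1) in place of u^(q-1); as e v <= u keeps w within a
    factor 2 of u, the two weights are comparable. No subtraction occurs, so
    that the inequality can be integrated even when integrals are infinite. *)
Lemma powR_perturb q e u v : 0 < q -> q < 1 -> 0 < e -> e <= 1 / 2 ->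
  0 <= u -> 0 <= v -> e * v <= u ->
  u `^ q + q * e / 2 * (u `^ (q - 1) * v) <=
  ((1 - e) * u + e * v) `^ q + 2 * q * e * u `^ q.
Proof.
move=> q0 q1 e0 e1 u0 v0 evu.
move: u0; rewrite le_eqVlt => /predU1P[u0|u0].
  rewrite -u0 in evu *.
  have -> : v = 0.
    by apply/eqP; rewrite eq_le v0 andbT; move: evu; rewrite pmulr_rle0.
  by rewrite !mulr0 addr0 powR0 ?gt_eqF// mulr0 !addr0.
set w := (1 - e) * u + e * v.
have w0 : 0 < w by rewrite /w; nra.
have uw : u <= 2 * w by rewrite /w; nra.
have wu : w <= 2 * u by rewrite /w; nra.
have tg := powR_tangent q0 q1 w0 (ltW u0).
have h1 := powRN_le2 q1 q0 u0 uw.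
have h2 := powRN_le2 q1 q0 w0 wu.
have uq : u `^ q = u `^ (q - 1) * u by rewrite mulrC mulr_powRB1// ltW.
have uwE : u - w = e * (u - v) by rewrite /w; ring.
move: tg; rewrite uwE => tg.
have h3 : w `^ (q - 1) * u <= 2 * u `^ q.
  by rewrite uq mulrA ler_wpM2r// ltW.
have h4 : u `^ (q - 1) * v <= 2 * (w `^ (q - 1) * v).
  by rewrite mulrA ler_wpM2r.
have qe0 : 0 < q * e by rewrite mulr_gt0.
have h3' := ler_wpM2l (ltW qe0) h3.
have h4' := ler_wpM2l (ltW qe0) h4.
lra.
Qed.

Lemma powR_convex p t x y : 1 <= p -> 0 <= t -> t <= 1 -> 0 <= x -> 0 <= y ->
  ((1 - t) * x + t * y) `^ p <= (1 - t) * x `^ p + t * y `^ p.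
Proof.
move=> p1 t0 t1 x0 y0.
have := @convex_powR R p p1 (Itv01 t0 t1) y x.
rewrite !inE/= !in_itv/= !andbT => /(_ y0 x0).
rewrite [X in X `^ p <= _ -> _]convRE [X in _ <= X -> _]convRE /=.
by rewrite /unstable.onem addrC [X in _ <= X -> _]addrC.
Qed.

End RealInequalities.

(** * Approximate maximizers *)

Section Maurey.
Context d (T : measurableType d) (R : realType).
Variable mu : {measure set T -> \bar R}.

Lemma measurable_powR_comp (f : T -> R) (r : R) : measurable_fun setT f ->
  measurable_fun setT (fun x => f x `^ r).
Proof. exact: (@measurableT_comp _ _ _ _ _ _ (@powR R ^~ r)). Qed.

Lemma ge0_integral_lincomb (f g : T -> R) (k : R) :
  measurable_fun setT f -> measurable_fun setT g ->
  (forall x, 0 <= f x) -> (forall x, 0 <= g x) -> 0 <= k ->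
  (\int[mu]_x (f x + k * g x)%:E =
   \int[mu]_x (f x)%:E + k%:E * \int[mu]_x (g x)%:E)%E.
Proof.
move=> mf mg f0 g0 k0.
under eq_integral do rewrite EFinD EFinM.
rewrite ge0_integralD//; last first.
- by apply/measurable_EFinP; exact: measurable_funM.
- by move=> x _; rewrite -EFinM lee_fin mulr_ge0.
- exact/measurable_EFinP.
- by move=> x _; rewrite lee_fin.
rewrite ge0_integralZl_EFin//; last exact/measurable_EFinP.
by move=> x _; rewrite lee_fin.
Qed.

Lemma chebyshev_powR (Q : set T) (f : T -> R) (l r : R) :
  measurable Q -> measurable_fun setT f -> (forall x, 0 <= f x) ->
  0 <= l -> (forall x, Q x -> l <= f x) -> 0 <= r ->
  ((l `^ r)%:E * mu Q <= \int[mu]_x (f x `^ r)%:E)%E.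
Proof.
move=> mQ mf f0 l0 lf r0.
have mi : measurable_fun setT (\1_Q : T -> R) by exact: measurable_indic.
have i0 x : 0 <= \1_Q x :> R by rewrite indicE ler0n.
apply: (@le_trans _ _ (\int[mu]_x (l `^ r * \1_Q x)%:E)%E).
  under eq_integral do rewrite EFinM.
  rewrite ge0_integralZl_EFin ?powR_ge0//; do ?[
    by move=> x _; rewrite lee_fin|exact/measurable_EFinP].
  by rewrite integral_indic// setIT.
apply: ge0_le_integral => //.
- by move=> x _; rewrite lee_fin mulr_ge0 ?powR_ge0.
- by apply/measurable_EFinP; exact: measurable_funM.
- by apply/measurable_EFinP; exact: measurable_powR_comp.
move=> x _; rewrite lee_fin; have [Qx|Qx] := pselect (Q x); last first.
  by rewrite indicE memNset// mulr0 powR_ge0.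
by rewrite indicE mem_set// mulr1 ge0_ler_powR ?nnegrE ?lf.
Qed.

(** The optimality condition behind Maurey's factorization. If u maximized the
    concave functional v |-> int v^q over the convex set V, its first variation
    in any direction v would yield int u^(q-1) v <= int u^q. A maximizer need
    not exist, but since any two elements of V are comparable (v <= M u), all
    first variations are controlled for one and the same step e: it is enough
    that u be maximal up to an error of order e, at the price of the
    constant 6. *)
Lemma approximate_maximizer (q L M : R) (V : set (T -> R)) :
  0 < q -> q < 1 -> 0 < L -> 0 < M -> V !=set0 ->
  (forall v, V v -> measurable_fun setT v) ->
  (forall v, V v -> forall x, 0 <= v x) ->
  (forall u v (e : R), V u -> V v -> 0 <= e -> e <= 1 ->
     V (fun x => (1 - e) * u x + e * v x)) ->
  (forall v, V v -> (\int[mu]_x (v x `^ q)%:E <= L%:E)%E) ->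
  (forall u v, V u -> V v -> forall x, v x <= M * u x) ->
  exists2 u, V u &
    forall v, V v -> (\int[mu]_x (u x `^ (q - 1) * v x)%:E <= (6 * L)%:E)%E.
Proof.
move=> q0 q1 L0 M0 [v0 Vv0] Vm Vge0 Vconv VL VM.
pose Phi (v : T -> R) := (\int[mu]_x (v x `^ q)%:E)%E.
have Phi0 v : (0 <= Phi v)%E.
  by apply: integral_ge0 => x _; rewrite lee_fin powR_ge0.
set S := ereal_sup (Phi @` V).
have SL : (S <= L%:E)%E by apply: ge_ereal_sup => _ [v Vv <-]; exact: VL.
have S0 : (0 <= S)%E.
  by apply: (le_trans (Phi0 v0)); apply: ereal_sup_ubound; exists v0.
have Sfin : S \is a fin_num by rewrite ge0_fin_numE// (le_lt_trans SL)// ltry.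
(* with e M <= 1, powR_perturb applies to every pair of elements of V *)
pose e := (M + 2)^-1.
have e0 : 0 < e by rewrite invr_gt0; lra.
have e1 : e <= 1 / 2.
  by rewrite /e div1r lef_pV2 ?posrE; lra.
have eM : e * M <= 1.
  by rewrite /e mulrC ler_pdivrMr; lra.
have qeL0 : 0 < q * e * L by rewrite !mulr_gt0.
have [_ [u Vu <-] uS] := ub_ereal_sup_adherent qeL0 Sfin.
exists u => // v Vv.
pose w x := (1 - e) * u x + e * v x.
have Vw : V w by apply: Vconv => //; lra.
have mp f r : V f -> measurable_fun setT (fun x => f x `^ r).
  by move=> Vf; apply: measurable_powR_comp; exact: Vm.
have muv : measurable_fun setT (fun x => u x `^ (q - 1) * v x).
  by apply: measurable_funM; [exact: mp|exact: Vm].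
have uv0 x : 0 <= u x `^ (q - 1) * v x by rewrite mulr_ge0 ?powR_ge0 ?Vge0.
have main : (Phi u + (q * e / 2)%:E * \int[mu]_x (u x `^ (q - 1) * v x)%:E
    <= Phi w + (2 * q * e)%:E * Phi u)%E.
  have qe2 : 0 <= q * e / 2 by rewrite divr_ge0// mulr_ge0// ltW.
  have qe3 : 0 <= 2 * q * e by rewrite !mulr_ge0// ltW.
  have muq := mp u q Vu; have mwq := mp w q Vw.
  rewrite /Phi -!ge0_integral_lincomb//; try by move=> x; rewrite powR_ge0.
  apply: ge0_le_integral => //.
  - by move=> x _; rewrite lee_fin addr_ge0 ?powR_ge0// mulr_ge0.
  - by apply/measurable_EFinP/measurable_funD => //; exact: measurable_funM.
  - by apply/measurable_EFinP/measurable_funD => //; exact: measurable_funM.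
  move=> x _; rewrite lee_fin; apply: powR_perturb => //.
  - exact: Vge0.
  - exact: Vge0.
  - have := VM u v Vu Vv x; have := Vge0 u Vu x; nra.
have PuE : Phi u = (fine (Phi u))%:E.
  by rewrite fineK// ge0_fin_numE// (le_lt_trans (VL _ Vu))// ltry.
have PwE : Phi w = (fine (Phi w))%:E.
  by rewrite fineK// ge0_fin_numE// (le_lt_trans (VL _ Vw))// ltry.
have wS : (Phi w <= S)%E by apply: ereal_sup_ubound; exists w.
have uL := VL u Vu; rewrite -/(Phi u) in uL.
set I := (\int[mu]_x _)%E in main *.
have I0 : (0 <= I)%E by apply: integral_ge0 => x _; rewrite lee_fin.
have [S' SE] : exists s, S = s%:E by exists (fine S); rewrite fineK.
rewrite -/S in uS.
move: main wS uL uS; rewrite PuE PwE SE.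
have qe2 : 0 < q * e / 2 by rewrite divr_gt0// mulr_gt0.
case: I I0 => [i| |]//; last by rewrite mulry gtr0_sg// mul1e.
rewrite -!EFinM -!EFinD -?EFinN -?EFinD !lee_fin ?lte_fin => i0 h1 h2 h3 h4.
have qe0 : 0 < q * e by rewrite mulr_gt0.
have h5 := ler_wpM2l (ltW qe0) h3.
have : q * e * i <= q * e * (6 * L) by lra.
by rewrite ler_pM2l.
Qed.

End Maurey.

(** * The maximal inequality for nested sets *)

Section MaximalFunction.
Context d (T : measurableType d) (R : realType).
Variable mu : {measure set T -> \bar R}.
Implicit Types (s : seq (set T)) (a : set T -> R) (v : T -> R) (t m : R).

Definition seq_cover s : set T := \bigcup_(Q in [set` s]) Q.

Definition nested (A B : set T) := [\/ A `<=` B, B `<=` A | A `&` B = set0].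

(** With a Q the mean of v over Q, this is the maximal function of v relative
    to the sets in s; with a Q = b Q it is a finite version of the supremum of
    the b Q 1_Q. The value 0 is taken off the sets. *)
Definition seqmax a s (x : T) : R := \big[Num.max/0]_(Q <- s) (a Q * \1_Q x).

Lemma measurable_seq_cover s : {in s, forall Q, measurable Q} ->
  measurable (seq_cover s).
Proof. by move=> ms; apply: fin_bigcup_measurable. Qed.

Lemma seq_coverP s x : seq_cover s x <-> exists2 Q, Q \in s & Q x.
Proof. by split => -[Q Qs Qx]; exists Q. Qed.

Lemma seq_cover_cons Q s : seq_cover (Q :: s) = Q `|` seq_cover s.
Proof.
apply/seteqP; split => x.
  move=> /seq_coverP[P]; rewrite inE => /predU1P[->|Ps] Px; [by left|right].
  by apply/seq_coverP; exists P.
case=> [Qx|/seq_coverP[P Ps Px]]; apply/seq_coverP.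
  by exists Q; rewrite // mem_head.
by exists P => //; rewrite inE Ps orbT.
Qed.

Lemma seq_cover_lty s : {in s, forall Q, measurable Q} ->
  {in s, forall Q, (mu Q < +oo)%E} -> (mu (seq_cover s) < +oo)%E.
Proof.
elim: s => [|Q s IH] ms fs.
  by rewrite /seq_cover set_nil bigcup_set0 measure0.
rewrite seq_cover_cons; apply: (le_lt_trans (measureU2 _ _ _)).
- by apply: ms; rewrite mem_head.
- by apply: measurable_seq_cover => P Ps; apply: ms; rewrite inE Ps orbT.
apply: lte_add_pinfty; first by apply: fs; rewrite mem_head.
by apply: IH => P Ps; [apply: ms|apply: fs]; rewrite inE Ps orbT.
Qed.

(** The weak-type bound of the maximal function. A nested family has the same
    union as its maximal members, which are pairwise disjoint, and the bound is
    additive over disjoint sets. The induction finds them one at a time: the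
    head of the list is either contained in another member, and dropped, or it
    absorbs all the members that it meets. *)
Lemma weak_type v m s :
  measurable_fun setT v -> (forall x, 0 <= v x) -> 0 <= m ->
  {in s, forall Q, measurable Q} -> {in s &, forall P Q, nested P Q} ->
  {in s, forall Q, (m%:E * mu Q <= \int[mu]_(x in Q) (v x)%:E)%E} ->
  (m%:E * mu (seq_cover s) <= \int[mu]_(x in seq_cover s) (v x)%:E)%E.
Proof.
move=> mv v0 m0; have [n] := ubnP (size s).
elim: n s => // n IH [|Q s] sn ms ns h.
  by rewrite /seq_cover set_nil bigcup_set0 measure0 integral_set0 mule0.
have Qin : Q \in Q :: s by rewrite mem_head.
have ss P : P \in s -> P \in Q :: s by rewrite inE orbC => ->.
have IH' r : {subset r <= s} -> (size r <= size s)%N ->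
    (m%:E * mu (seq_cover r) <= \int[mu]_(x in seq_cover r) (v x)%:E)%E.
  move=> rs sr; apply: IH.
  - exact: leq_ltn_trans sr _.
  - by move=> P /rs/ss; exact: ms.
  - by move=> P P' /rs/ss ? /rs/ss ?; exact: ns.
  - by move=> P /rs/ss; exact: h.
have [[P Ps QP]|nQ] := pselect (exists2 P, P \in s & Q `<=` P).
  have -> : seq_cover (Q :: s) = seq_cover s; last exact: IH'.
  rewrite seq_cover_cons; apply/setUidPr => x /QP Px.
  by apply/seq_coverP; exists P.
pose r := [seq P <- s | `[< Q `&` P = set0 >]].
have rs : {subset r <= s} by move=> P; rewrite mem_filter => /andP[].
have QrE : seq_cover (Q :: s) = Q `|` seq_cover r.
  rewrite seq_cover_cons; apply/seteqP; split => x [Qx|/seq_coverP[P Ps Px]];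
    [by left| |by left|].
    have [QP|PQ|QP] := ns _ _ Qin (ss _ Ps).
    - by exfalso; apply: nQ; exists P.
    - by left; exact: PQ.
    - right; apply/seq_coverP; exists P => //.
      by rewrite mem_filter Ps andbT; exact/asboolP.
  by right; apply/seq_coverP; exists P => //; exact: rs.
have mQ := ms _ Qin.
have mr : measurable (seq_cover r).
  by apply: measurable_seq_cover => P /rs/ss; exact: ms.
have Qr0 : Q `&` seq_cover r = set0.
  rewrite -subset0 => x [Qx /seq_coverP[P]].
  rewrite mem_filter => /andP[/asboolP QP _] Px.
  by rewrite -QP.
rewrite QrE measureU// ge0_muleDr//.
rewrite ge0_integral_setU//; last first.
- exact/eqP.
- by move=> x _; rewrite lee_fin.
- by apply/measurable_EFinP; exact: measurable_funTS.
apply: leeD; first exact: h.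
by apply: IH' => //; rewrite size_filter count_size.
Qed.

Lemma seqmax_ge0 a s x : 0 <= seqmax a s x.
Proof. exact: bigmax_ge_id. Qed.

Lemma seqmax_cons a Q s x :
  seqmax a (Q :: s) x = Num.max (a Q * \1_Q x) (seqmax a s x).
Proof. by rewrite /seqmax big_cons. Qed.

Lemma seqmax_ub a s Q x : Q \in s -> a Q * \1_Q x <= seqmax a s x.
Proof.
by move=> Qs; exact: (le_bigmax_seq _ Q xpredT (fun Q => a Q * \1_Q x) Qs).
Qed.

Lemma seqmax_le a s x y : 0 <= y ->
  (forall Q, Q \in s -> a Q * \1_Q x <= y) -> seqmax a s x <= y.
Proof.
move=> y0 h; rewrite /seqmax big_seq; apply: bigmax_le => // Q; exact: h.
Qed.

Lemma seqmax_out a s x : ~ seq_cover s x -> seqmax a s x = 0.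
Proof.
move=> xs; apply/eqP; rewrite eq_le seqmax_ge0 andbT seqmax_le// => Q Qs.
rewrite indicE memNset ?mulr0// => Qx; apply: xs.
by apply/seq_coverP; exists Q.
Qed.

Lemma seqmax_in a m s x : {in s, forall Q, m <= a Q} -> seq_cover s x ->
  m <= seqmax a s x.
Proof.
move=> h /seq_coverP[Q Qs Qx]; apply: (le_trans (h _ Qs)).
apply: le_trans (seqmax_ub a x Qs).
by rewrite indicE mem_set// mulr1.
Qed.

Lemma measurable_seqmax a s : {in s, forall Q, measurable Q} ->
  measurable_fun setT (seqmax a s).
Proof.
elim: s => [_|Q s IH ms].
  by rewrite /seqmax; under eq_fun do rewrite big_nil; exact: measurable_cst.
rewrite (_ : seqmax a (Q :: s) =
  (fun x => Num.max (a Q * \1_Q x) (seqmax a s x))); last first.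
  by apply/funext => x; rewrite seqmax_cons.
apply: measurable_maxr.
  apply: measurable_funM => //; apply: measurable_indic.
  by apply: ms; rewrite mem_head.
by apply: IH => P Ps; apply: ms; rewrite inE Ps orbT.
Qed.

(** When a Q is the least of the values, the level set {seqmax a >= a Q} is the
    whole union: this splits off the lowest layer of a layer-cake decomposition
    of phi (seqmax a). *)
Let seqmax_layer a m (Q : set T) s t x :
  a Q = m -> 0 <= t -> t <= m ->
  {in s, forall P, m <= a P} -> forall phi : R -> R,
  (phi (seqmax a (Q :: s) x) - phi t) * \1_(seq_cover (Q :: s)) x =
  (phi m - phi t) * \1_(seq_cover (Q :: s)) x +
  (phi (seqmax a s x) - phi m) * \1_(seq_cover s) x.
Proof.
move=> aQ t0 tm ms phi.
have m0 : 0 <= m by apply: le_trans tm.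
have [xs|xs] := pselect (seq_cover s x).
  have xQ : seq_cover (Q :: s) x by rewrite seq_cover_cons; right.
  rewrite !indicE !mem_set// !mulr1 seqmax_cons max_r; first by ring.
  apply: le_trans (seqmax_in ms xs).
  by rewrite indicE aQ; case: (_ \in _); rewrite ?mulr1// mulr0.
rewrite [X in _ + _ * X]indicE (memNset xs) mulr0 addr0 seqmax_cons.
rewrite seqmax_out// seq_cover_cons.
have [Qx|Qx] := pselect (Q x).
  by rewrite !indicE !mem_set ?mulr1//; [rewrite aQ max_l|left].
by rewrite !indicE !memNset ?mulr0// => -[].
Qed.

(** The layer-cake proof of the L^2 bound, with the layers listed by increasing
    value of a and t the bottom of the next one: on each layer
    a^2 - t^2 <= 2 a (a - t), and the weak-type bound replaces a times the
    measure of the level set by the integral of v over it. *)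
Let seqmax_sqr_le v a s t :
  measurable_fun setT v -> (forall x, 0 <= v x) -> 0 <= t ->
  sorted (fun P Q => a P <= a Q) s -> {in s, forall P, t <= a P} ->
  {in s, forall Q, measurable Q} -> {in s &, forall P Q, nested P Q} ->
  {in s, forall Q, ((a Q)%:E * mu Q <= \int[mu]_(x in Q) (v x)%:E)%E} ->
  (\int[mu]_x (((seqmax a s x) ^+ 2 - t ^+ 2) * \1_(seq_cover s) x)%:E <=
   \int[mu]_x (2 * v x * ((seqmax a s x - t) * \1_(seq_cover s) x))%:E)%E.
Proof.
move=> mv v0.
elim: s t => [|Q s IH] t t0 sorts ta ms ns h.
  rewrite le_eqVlt; apply/orP; left; apply/eqP; apply: eq_integral => x _.
  by rewrite /seq_cover set_nil bigcup_set0 indic0 !mulr0.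
have Qin : Q \in Q :: s by rewrite mem_head.
have ss P : P \in s -> P \in Q :: s by rewrite inE orbC => ->.
have tm := ta _ Qin.
have m0 : 0 <= a Q by exact: le_trans tm.
have ma : {in s, forall P, a Q <= a P}.
  move: sorts; rewrite /= => /order_path_min /allP; apply.
  by move=> P P' P''; exact: le_trans.
have ms' : {in s, forall Q, measurable Q} by move=> P /ss; exact: ms.
have mc : measurable (seq_cover (Q :: s)) by exact: measurable_seq_cover.
have mc' : measurable (seq_cover s) by exact: measurable_seq_cover.
have mi : measurable_fun setT (\1_(seq_cover (Q :: s)) : T -> R).
  exact: measurable_indic.
have mi' : measurable_fun setT (\1_(seq_cover s) : T -> R).
  exact: measurable_indic.
have msm := measurable_seqmax a ms'.
have i0 A x : 0 <= \1_A x :> R by rewrite indicE ler0n.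
have smin x : 0 <= (seqmax a s x - a Q) * \1_(seq_cover s) x.
  have [xs|xs] := pselect (seq_cover s x).
    by rewrite mulr_ge0// subr_ge0 seqmax_in.
  by rewrite indicE memNset// mulr0.
have smin2 x : 0 <= (seqmax a s x ^+ 2 - a Q ^+ 2) * \1_(seq_cover s) x.
  by rewrite subr_sqr mulrAC mulr_ge0// addr_ge0// seqmax_ge0.
under eq_integral => x _ do
  rewrite (seqmax_layer x erefl t0 tm ma (fun y => y ^+ 2)).
under [leRHS]eq_integral => x _ do
  rewrite (seqmax_layer x erefl t0 tm ma id) mulrDr.
under eq_integral do rewrite EFinD.
under [leRHS]eq_integral do rewrite EFinD.
have tm2 : 0 <= a Q - t by rewrite subr_ge0.
have tm3 : 0 <= a Q ^+ 2 - t ^+ 2 by rewrite subr_sqr mulr_ge0// addr_ge0.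
have msm2 : measurable_fun setT (fun x => seqmax a s x ^+ 2).
  exact: measurable_funX.
have m1 : measurable_fun setT
    (fun x => (seqmax a s x ^+ 2 - a Q ^+ 2) * \1_(seq_cover s) x).
  by apply: measurable_funM => //; exact: measurable_funB.
have m2 : measurable_fun setT
    (fun x => 2 * v x * ((seqmax a s x - a Q) * \1_(seq_cover s) x)).
  apply: measurable_funM; first exact: measurable_funM.
  by apply: measurable_funM => //; exact: measurable_funB.
have m3 (k : R) : measurable_fun setT (fun x => k * \1_(seq_cover (Q :: s)) x).
  exact: measurable_funM.
have m4 : measurable_fun setT
    (fun x => 2 * v x * ((a Q - t) * \1_(seq_cover (Q :: s)) x)).
  by apply: measurable_funM => //; exact: measurable_funM.
have n2 x : 0 <= 2 * v x * ((seqmax a s x - a Q) * \1_(seq_cover s) x).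
  by rewrite mulr_ge0// mulr_ge0.
have n4 x : 0 <= 2 * v x * ((a Q - t) * \1_(seq_cover (Q :: s)) x).
  by rewrite mulr_ge0// mulr_ge0.
rewrite !ge0_integralD//; do ?[by move=> x _; rewrite lee_fin
  |by move=> x _; rewrite lee_fin mulr_ge0|by apply/measurable_EFinP].
apply: leeD; last first.
  apply: IH => //.
  - by move: sorts => /= /path_sorted.
  - by move=> P P' /ss ? /ss ?; exact: ns.
  - by move=> P /ss; exact: h.
have w : ((a Q)%:E * mu (seq_cover (Q :: s)) <=
    \int[mu]_(x in seq_cover (Q :: s)) (v x)%:E)%E.
  apply: weak_type => // P PQs; apply: le_trans (h _ PQs).
  apply: lee_wpmul2r => //; rewrite lee_fin.
  by move: PQs; rewrite inE => /predU1P[->//|/ma].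
under eq_integral do rewrite EFinM.
rewrite ge0_integralZl_EFin//; do ?[exact/measurable_EFinP
  |by move=> x _; rewrite lee_fin].
rewrite integral_indic// setIT.
have -> : (\int[mu]_x (2 * v x * ((a Q - t) * \1_(seq_cover (Q :: s)) x))%:E =
   (2 * (a Q - t))%:E * \int[mu]_(x in seq_cover (Q :: s)) (v x)%:E)%E.
  under eq_integral do rewrite mulrACA EFinM.
  rewrite ge0_integralZl_EFin//; last first.
  - by rewrite mulr_ge0.
  - by apply/measurable_EFinP; exact: measurable_funM.
  - by move=> x _; rewrite lee_fin mulr_ge0.
  congr (_ * _)%E; rewrite [RHS]integral_mkcond; apply: eq_integral => x _.
  by rewrite patchE indicE; case: ifP => _; rewrite ?mulr1 ?mulr0.
apply: (@le_trans _ _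
  ((2 * (a Q - t))%:E * ((a Q)%:E * mu (seq_cover (Q :: s))))%E).
  rewrite muleA -EFinM; apply: lee_wpmul2r => //; rewrite lee_fin.
  rewrite subr_sqr; nra.
by apply: lee_wpmul2l => //; rewrite lee_fin mulr_ge0.
Qed.

(** From int M^2 <= 2 int v M, where M is the maximal function, the arithmetic
    mean inequality 2 v M <= 2 v^2 + M^2 / 2 allows int M^2, which is finite, to
    be absorbed into the left-hand side. *)
Lemma maximal_L2 v a s :
  measurable_fun setT v -> (forall x, 0 <= v x) ->
  {in s, forall Q, 0 <= a Q} ->
  {in s, forall Q, measurable Q} -> {in s, forall Q, (mu Q < +oo)%E} ->
  {in s &, forall P Q, nested P Q} ->
  {in s, forall Q, ((a Q)%:E * mu Q <= \int[mu]_(x in Q) (v x)%:E)%E} ->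
  (\int[mu]_x ((seqmax a s x) ^+ 2)%:E <= 4%:E * \int[mu]_x (v x ^+ 2)%:E)%E.
Proof.
move=> mv v0 a0 ms fs ns h.
pose leA (P Q : set T) := a P <= a Q.
pose r := sort leA s.
have rs : r =i s by move=> P; rewrite mem_sort.
have Mrs x : seqmax a s x = seqmax a r x.
  apply/eqP; rewrite eq_le; apply/andP; split; apply: seqmax_le => //.
  - exact: seqmax_ge0.
  - by move=> Q Qs; apply: seqmax_ub; rewrite rs.
  - exact: seqmax_ge0.
  - by move=> Q Qs; apply: seqmax_ub; rewrite -rs.
have msm := measurable_seqmax a ms.
have key : (\int[mu]_x ((seqmax a s x) ^+ 2)%:E <=
    \int[mu]_x (2 * v x * seqmax a s x)%:E)%E.
  have out x : ~ seq_cover r x -> seqmax a r x = 0 by exact: seqmax_out.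
  have mn : sorted leA r by apply: sort_sorted => P P'; exact: le_total.
  have := @seqmax_sqr_le v a r 0 mv v0 (lexx _) mn.
  have E x : seqmax a r x * \1_(seq_cover r) x = seqmax a r x.
    have [xr|xr] := pselect (seq_cover r x).
      by rewrite indicE mem_set// mulr1.
    by rewrite out// mul0r.
  under eq_integral do rewrite expr0n subr0 expr2 -mulrA E -expr2 -Mrs.
  under [X in (_ -> _ -> _ -> _ -> _ <= X)%E -> _]eq_integral do
    rewrite subr0 E -Mrs.
  apply.
  - by move=> P; rewrite rs; exact: a0.
  - by move=> P; rewrite rs; exact: ms.
  - by move=> P P'; rewrite !rs; exact: ns.
  - by move=> P; rewrite rs; exact: h.
have mc : measurable (seq_cover s) by exact: measurable_seq_cover.
pose B := \sum_(Q <- s) a Q.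
have B0 : 0 <= B by rewrite /B big_seq sumr_ge0.
have Mb x : seqmax a s x ^+ 2 <= B ^+ 2 * \1_(seq_cover s) x.
  have [xs|xs] := pselect (seq_cover s x); last first.
    by rewrite seqmax_out// expr0n/= mulr_ge0 ?exprn_ge0// indicE ler0n.
  rewrite indicE mem_set// mulr1 lerXn2r ?nnegrE ?seqmax_ge0//.
  apply: seqmax_le => // Q Qs.
  rewrite /B (big_rem Q)//= -[leLHS]addr0 lerD//.
    by rewrite indicE; case: (_ \in _); rewrite ?mulr1// mulr0 a0.
  by rewrite big_seq sumr_ge0// => P /mem_rem/a0.
have fc : (mu (seq_cover s) < +oo)%E by exact: seq_cover_lty.
have Mfin : (\int[mu]_x ((seqmax a s x) ^+ 2)%:E < +oo)%E.
  apply: (@le_lt_trans _ _ (\int[mu]_x (B ^+ 2 * \1_(seq_cover s) x)%:E)%E).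
    apply: ge0_le_integral => //.
    - by move=> x _; rewrite lee_fin sqr_ge0.
    - by apply/measurable_EFinP; exact: measurable_funX.
    - by apply/measurable_EFinP; apply: measurable_funM.
    - by move=> x _; rewrite lee_fin.
  under eq_integral do rewrite EFinM.
  rewrite ge0_integralZl_EFin ?sqr_ge0//; do ?[
    by apply/measurable_EFinP; exact: measurable_indic].
  by rewrite integral_indic// setIT lte_mul_pinfty// lee_fin sqr_ge0.
have amgm : (\int[mu]_x (2 * v x * seqmax a s x)%:E <=
    2%:E * \int[mu]_x (v x ^+ 2)%:E +
    (1 / 2)%:E * \int[mu]_x ((seqmax a s x) ^+ 2)%:E)%E.
  rewrite -ge0_integralZl_EFin//; last first.
  - by apply/measurable_EFinP; exact: measurable_funX.
  - by move=> x _; rewrite lee_fin sqr_ge0.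
  under [X in (_ <= X + _)%E]eq_integral do rewrite -EFinM.
  rewrite -ge0_integral_lincomb//; last first.
  - by move=> x; rewrite sqr_ge0.
  - by move=> x; rewrite mulr_ge0 ?sqr_ge0.
  - exact: measurable_funX.
  - by apply: measurable_funM => //; exact: measurable_funX.
  apply: ge0_le_integral => //.
  - by move=> x _; rewrite lee_fin !mulr_ge0 ?seqmax_ge0.
  - apply/measurable_EFinP; apply: measurable_funM => //.
    exact: measurable_funM.
  - apply/measurable_EFinP; apply: measurable_funD;
      do 2 ?apply: measurable_funM => //; exact: measurable_funX.
  by move=> x _; rewrite lee_fin; have := sqr_ge0 (2 * v x - seqmax a s x); nra.
have := le_trans key amgm.
have : (0 <= \int[mu]_x (v x ^+ 2)%:E)%E.
  by apply: integral_ge0 => x _; rewrite lee_fin sqr_ge0.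
have : (0 <= \int[mu]_x ((seqmax a s x) ^+ 2)%:E)%E.
  by apply: integral_ge0 => x _; rewrite lee_fin sqr_ge0.
move: Mfin.
case: (\int[mu]_x ((seqmax a s x) ^+ 2)%:E)%E => [i| |]// _ _.
case: (\int[mu]_x (v x ^+ 2)%:E)%E => [j| |]//; last first.
  by move=> _ _; rewrite mulry gtr0_sg// mul1e leey.
rewrite -!EFinM -EFinD !lee_fin; lra.
Qed.

End MaximalFunction.

(** * Step functions and averages *)

Section StepFunctions.
Context d (T : measurableType d) (R : realType).
Implicit Types (s : seq (set T)) (a : set T -> R) (f w : T -> R).

Definition stepfun a s (x : T) : R := \sum_(Q <- s) a Q * \1_Q x.

Definition avg (mu : {measure set T -> \bar R}) (Q : set T) f : R :=
  \int[mu]_(x in Q) f x / fine (mu Q).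

Lemma measurable_stepfun a s : {in s, forall Q, measurable Q} ->
  measurable_fun setT (stepfun a s).
Proof.
elim: s => [_|Q s IH ms].
  rewrite (_ : stepfun a [::] = cst 0) ?measurable_cst//.
  by apply/funext => x; rewrite /stepfun big_nil.
rewrite (_ : stepfun a (Q :: s) = (fun x => a Q * \1_Q x + stepfun a s x)).
  apply: measurable_funD.
    by apply: measurable_funM => //; apply/measurable_indic/ms/mem_head.
  by apply: IH => P Ps; apply: ms; rewrite inE Ps orbT.
by apply/funext => x; rewrite /stepfun big_cons.
Qed.

Lemma indic_ge0 (A : set T) x : 0 <= \1_A x :> R.
Proof. by rewrite indicE ler0n. Qed.

Lemma stepfun_ge0 a s x : {in s, forall Q, 0 <= a Q} -> 0 <= stepfun a s x.
Proof.
by move=> a0; rewrite /stepfun big_seq sumr_ge0// => Q Qs;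
  rewrite mulr_ge0 ?a0// indic_ge0.
Qed.

Lemma stepfun_ge a s Q x : {in s, forall Q, 0 <= a Q} -> Q \in s -> Q x ->
  a Q <= stepfun a s x.
Proof.
move=> a0 Qs Qx; rewrite /stepfun (big_rem Q)//= indicE mem_set// mulr1.
rewrite lerDl big_seq sumr_ge0// => P /mem_rem Ps.
by rewrite mulr_ge0 ?a0 ?indic_ge0.
Qed.

Variable mu : {measure set T -> \bar R}.

Lemma ge0_integral_mul_stepfun w a s :
  measurable_fun setT w -> (forall x, 0 <= w x) ->
  {in s, forall Q, measurable Q} -> {in s, forall Q, 0 <= a Q} ->
  (\int[mu]_x (w x * stepfun a s x)%:E =
   \sum_(Q <- s) (a Q)%:E * \int[mu]_(x in Q) (w x)%:E)%E.
Proof.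
move=> mw w0; elim: s => [|Q s IH] ms a0.
  rewrite big_nil; under eq_integral do rewrite /stepfun big_nil mulr0.
  by rewrite integral0.
have Qs : Q \in Q :: s by rewrite mem_head.
have ms' : {in s, forall Q, measurable Q}.
  by move=> P Ps; apply: ms; rewrite inE Ps orbT.
have a0' : {in s, forall Q, 0 <= a Q}.
  by move=> P Ps; apply: a0; rewrite inE Ps orbT.
under eq_integral do rewrite /stepfun big_cons mulrDr -/(stepfun _ _ _) EFinD.
rewrite ge0_integralD//; last 4 first.
- by move=> x _; rewrite lee_fin !mulr_ge0 ?a0 ?indic_ge0.
- apply/measurable_EFinP; apply: measurable_funM => //.
  by apply: measurable_funM => //; exact/measurable_indic/ms.
- by move=> x _; rewrite lee_fin mulr_ge0 ?stepfun_ge0.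
- apply/measurable_EFinP; apply: measurable_funM => //.
  exact: measurable_stepfun.
rewrite big_cons IH//; congr (_ + _)%E.
under eq_integral do rewrite mulrCA EFinM.
rewrite ge0_integralZl_EFin//; last 3 first.
- by move=> x _; rewrite lee_fin mulr_ge0 ?indic_ge0.
- apply/measurable_EFinP; apply: measurable_funM => //.
  exact/measurable_indic/ms.
- exact: a0.
congr (_ * _)%E; rewrite [RHS]integral_mkcond; apply: eq_integral => x _.
by rewrite patchE indicE; case: ifP => _; rewrite ?mulr1 ?mulr0.
Qed.

Lemma ge0_integrable (Q : set T) f :
  measurable Q -> measurable_fun setT f -> (forall x, 0 <= f x) ->
  (\int[mu]_(x in Q) (f x)%:E < +oo)%E -> mu.-integrable Q (EFin \o f).
Proof.
move=> mQ mf f0 h; apply/integrableP; split.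
  by apply/measurable_EFinP; exact: measurable_funTS.
apply: le_lt_trans h; apply: ge0_le_integral => //.
- apply: measurableT_comp => //; apply/measurable_EFinP.
  exact: measurable_funTS.
- by apply/measurable_EFinP; exact: measurable_funTS.
- by move=> x _ /=; rewrite ger0_norm.
Qed.

(** Jensen's inequality for the convex function t |-> t^(-r), by integrating its
    tangent at the mean of f. *)
Lemma jensen_powRN (Q : set T) f (r : R) : 0 < r ->
  measurable Q -> (0 < mu Q < +oo)%E ->
  mu.-integrable Q (EFin \o f) -> (forall x, Q x -> 0 < f x) ->
  mu.-integrable Q (EFin \o (fun x => f x `^ (- r))) ->
  0 < avg mu Q f ->
  avg mu Q f `^ (- r) <= avg mu Q (fun x => f x `^ (- r)).
Proof.
move=> r0 mQ /andP[Q0 Qoo] intf f0 intfr; set m := avg mu Q f => m0.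
have fQ0 : 0 < fine (mu Q) by rewrite fine_gt0// Q0.
rewrite /avg ler_pdivlMr//.
have intc k : mu.-integrable Q (EFin \o (fun _ : T => k)).
  apply/integrableP; split; first exact: measurable_cst.
  by rewrite integral_cst// lte_mul_pinfty// lee_fin.
have intl k : mu.-integrable Q (EFin \o (fun x => k * f x)).
  rewrite (_ : EFin \o _ = fun x => (k%:E * (f x)%:E)%E)//.
  exact: integrableZl.
have : \int[mu]_(x in Q) (m `^ (- r) * (1 + r)) <=
    \int[mu]_(x in Q) (f x `^ (- r) + r * m `^ (- r) / m * f x).
  apply: le_Rintegral => //; first exact: (integrableD mQ intfr (intl _)).
  by move=> x /f0 fx; exact: powRN_tangent.
rewrite Rintegral_cst// RintegralD//.
rewrite RintegralZl//.
have -> : \int[mu]_(x in Q) f x = m * fine (mu Q).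
  by rewrite /m /avg divfK// gt_eqF.
rewrite mulrA divfK ?gt_eqF//; lra.
Qed.

End StepFunctions.

(** * Factorization over finitely many cubes *)

Section FiniteFactorization.
Context d (T : measurableType d) (R : realType).
Variables (sigma omega : {measure set T -> \bar R}) (p q : R).
Hypotheses (p1 : 1 <= p) (q0 : 0 < q) (q1 : q < 1).
Implicit Types (s : seq (set T)) (f g h : T -> R).

(** The non-negative part of the unit ball of L^p(sigma). *)
Definition ball_Lp : set (T -> R) := [set h : T -> R |
  [/\ measurable_fun setT h, forall x, 0 <= h x &
      (\int[sigma]_x (h x `^ p)%:E <= 1)%E]].

Lemma ball_Lp_convex g h (t : R) : ball_Lp g -> ball_Lp h -> 0 <= t -> t <= 1 ->
  ball_Lp (fun x => (1 - t) * g x + t * h x).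
Proof.
move=> [mg g0 g1] [mh h0 h1] t0 t1; have t2 : 0 <= 1 - t by rewrite subr_ge0.
have mc : measurable_fun setT (fun x => (1 - t) * g x + t * h x).
  by apply: measurable_funD; exact: measurable_funM.
split; [exact: mc|by move=> x; rewrite addr_ge0 ?mulr_ge0|].
have mgp : measurable_fun setT (fun x => g x `^ p).
  exact: measurable_powR_comp.
have mhp : measurable_fun setT (fun x => h x `^ p).
  exact: measurable_powR_comp.
apply: (@le_trans _ _ (\int[sigma]_x ((1 - t) * g x `^ p + t * h x `^ p)%:E)%E).
  apply: ge0_le_integral => //.
  - by move=> x _; rewrite lee_fin powR_ge0.
  - by apply/measurable_EFinP; exact: measurable_powR_comp.
  - by apply/measurable_EFinP; apply: measurable_funD; exact: measurable_funM.
  - by move=> x _; rewrite lee_fin; exact: powR_convex.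
rewrite ge0_integral_lincomb//; last 3 first.
- exact: measurable_funM.
- by move=> x; rewrite mulr_ge0 ?powR_ge0.
- by move=> x; rewrite powR_ge0.
under eq_integral do rewrite EFinM.
rewrite ge0_integralZl_EFin//; last 2 first.
- by move=> x _; rewrite lee_fin powR_ge0.
- exact/measurable_EFinP.
apply: (@le_trans _ _ ((1 - t)%:E * 1 + t%:E * 1)%E).
  by apply: leeD; apply: lee_wpmul2l;
    [rewrite lee_fin|exact: g1|rewrite lee_fin|exact: h1].
by rewrite !mule1 -EFinD subrK.
Qed.

(** Since h <= 1 + h^p, functions of L^p are integrable on sets of finite
    measure. *)
Lemma ge0_integral_le_powR h (Q : set T) : measurable_fun setT h ->
  (forall x, 0 <= h x) -> measurable Q ->
  (\int[sigma]_(x in Q) (h x)%:E <=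
   sigma Q + \int[sigma]_x (h x `^ p)%:E)%E.
Proof.
move=> mh h0 mQ.
have mhp : measurable_fun setT (fun x => h x `^ p).
  exact: measurable_powR_comp.
apply: (@le_trans _ _ (\int[sigma]_(x in Q) (1 + h x `^ p)%:E)%E).
  apply: ge0_le_integral => //.
  - by move=> x _; rewrite lee_fin.
  - by apply/measurable_EFinP; exact: measurable_funTS.
  - apply/measurable_EFinP; apply: measurable_funD => //.
    exact: measurable_funTS.
  - move=> x _; rewrite lee_fin; have [hx|hx] := leP 1 (h x).
      by apply: (le_trans (le1r_powR hx p1)); rewrite lerDr.
    by apply: (le_trans (ltW hx)); rewrite lerDl powR_ge0.
under eq_integral do rewrite EFinD.
rewrite ge0_integralD//; last 2 first.
- by move=> x _; rewrite lee_fin powR_ge0.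
- by apply/measurable_EFinP; exact: measurable_funTS.
rewrite integral_cst// mul1e; apply: leeD => //.
apply: ge0_subset_integral => //; last by move=> x _; rewrite lee_fin powR_ge0.
exact/measurable_EFinP.
Qed.

Lemma ball_Lp_integral h (Q : set T) : ball_Lp h -> measurable Q ->
  (\int[sigma]_(x in Q) (h x)%:E <= sigma Q + 1)%E.
Proof.
move=> [mh h0 h1] mQ; apply: (le_trans (ge0_integral_le_powR mh h0 mQ)).
exact: leeD.
Qed.

Lemma ball_Lp_indic (E : set T) : measurable E -> (sigma E < +oo)%E ->
  exists2 k : R, 0 < k & ball_Lp (fun x => k * \1_E x).
Proof.
move=> mE fE.
pose S := fine (sigma E).
have SE : sigma E = S%:E by rewrite fineK// ge0_fin_numE.
have S0 : 0 <= S by rewrite fine_ge0.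
pose k := (1 + S)^-1.
have k0 : 0 < k by rewrite invr_gt0; lra.
have k1 : k <= 1 by rewrite invf_le1; lra.
have kp : k `^ p <= k by apply: ge1r_powR => //; rewrite k0 k1.
have mi : measurable_fun setT (\1_E : T -> R) by exact: measurable_indic.
exists k => //; split; first exact: measurable_funM.
  by move=> x; rewrite mulr_ge0 ?indic_ge0// ltW.
apply: (@le_trans _ _ (\int[sigma]_x (k * \1_E x)%:E)%E).
  apply: ge0_le_integral => //.
  - by move=> x _; rewrite lee_fin powR_ge0.
  - by apply/measurable_EFinP/measurable_powR_comp; exact: measurable_funM.
  - by apply/measurable_EFinP; exact: measurable_funM.
  move=> x _; rewrite lee_fin indicE; case: (_ \in _) => /=.
    by rewrite !mulr1.
  by rewrite !mulr0 powR0// gt_eqF// (lt_le_trans ltr01).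
under eq_integral do rewrite EFinM.
rewrite ge0_integralZl_EFin ?(ltW k0)//; last exact/measurable_EFinP.
by rewrite integral_indic// setIT SE -EFinM lee_fin /k mulrC ler_pdivrMr; lra.
Qed.

Lemma avg_indic (E Q : set T) (k : R) : measurable Q -> (0 < sigma Q < +oo)%E ->
  Q `<=` E -> avg sigma Q (fun x => k * \1_E x) = k.
Proof.
move=> mQ /andP[Q0 Qoo] QE.
rewrite /avg (_ : \int[sigma]_(x in Q) (k * \1_E x) = \int[sigma]_(x in Q) k).
  by rewrite Rintegral_cst// mulfK// gt_eqF// fine_gt0// Q0.
apply: eq_Rintegral => x; rewrite inE => Qx.
by rewrite indicE mem_set ?mulr1//; exact: QE.
Qed.

Lemma ball_Lp_integrable h (Q : set T) : ball_Lp h -> measurable Q ->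
  (sigma Q < +oo)%E -> sigma.-integrable Q (EFin \o h).
Proof.
move=> hb mQ Qoo; have [mh h0 h1] := hb; apply: ge0_integrable => //.
by apply: (le_lt_trans (ball_Lp_integral hb mQ)); rewrite lte_add_pinfty// ltry.
Qed.

Lemma avg_lincomb g h (t : R) (Q : set T) : ball_Lp g -> ball_Lp h ->
  measurable Q -> (sigma Q < +oo)%E ->
  avg sigma Q (fun x => (1 - t) * g x + t * h x) =
  (1 - t) * avg sigma Q g + t * avg sigma Q h.
Proof.
move=> gb hb mQ Qoo.
have ig := ball_Lp_integrable gb mQ Qoo.
have ih := ball_Lp_integrable hb mQ Qoo.
have iZ (k : R) f : sigma.-integrable Q (EFin \o f) ->
    sigma.-integrable Q (EFin \o (fun x => k * f x)).
  move=> fi; rewrite (_ : EFin \o _ = fun x => (k%:E * (f x)%:E)%E)//.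
  exact: integrableZl.
rewrite /avg RintegralD//; [|exact: iZ|exact: iZ].
by rewrite !RintegralZl// mulrDl -!mulrA.
Qed.

Lemma avg_ge0 (mu : {measure set T -> \bar R}) Q f :
  (forall x, 0 <= f x) -> 0 <= avg mu Q f.
Proof.
by move=> f0; apply: divr_ge0; [exact: Rintegral_ge0|exact: fine_ge0].
Qed.

Variables (lambda : set T -> R) (s : seq (set T)) (L : R).
Hypothesis L0 : 0 < L.
Hypothesis ms : {in s, forall Q, measurable Q}.
Hypothesis sigmas : {in s, forall Q, (0 < sigma Q < +oo)%E}.
Hypothesis omegas : {in s, forall Q, (0 < omega Q < +oo)%E}.
Hypothesis ns : {in s &, forall P Q, nested P Q}.
Hypothesis lambda0 : {in s, forall Q, 0 < lambda Q}.

(** The operator restricted to the sets in s. *)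
Let Top f := stepfun (fun Q => lambda Q * avg sigma Q f) s.

Hypothesis TL : forall h, ball_Lp h ->
  (\int[omega]_x (Top h x `^ q)%:E <= L%:E)%E.

Let Top_lincomb g h (t : R) x : ball_Lp g -> ball_Lp h ->
  Top (fun x => (1 - t) * g x + t * h x) x = (1 - t) * Top g x + t * Top h x.
Proof.
move=> gb hb; rewrite /Top /stepfun !big_distrr/= -big_split/=.
rewrite big_seq [RHS]big_seq; apply: eq_bigr => Q Qs.
have /andP[_ sQ] := sigmas Qs.
rewrite avg_lincomb//; [by ring|exact: ms].
Qed.

Let Top_coef h : (forall x, 0 <= h x) ->
  {in s, forall Q, 0 <= lambda Q * avg sigma Q h}.
Proof. by move=> h0 Q Qs; rewrite mulr_ge0 ?avg_ge0// ltW ?lambda0. Qed.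

Let Top_ge0 h x : (forall x, 0 <= h x) -> 0 <= Top h x.
Proof. by move=> h0; apply: stepfun_ge0; exact: Top_coef. Qed.

Let measurable_Top h : measurable_fun setT (Top h).
Proof. exact: measurable_stepfun. Qed.

(** A function in the ball whose averages over all the sets in s are bounded
    below. Averaging it with the members of the ball keeps the images under Top
    away from 0 and comparable with each other, as approximate_maximizer
    requires. *)
Let bottom : exists2 g, ball_Lp g & exists2 k : R, 0 < k &
  {in s, forall Q, avg sigma Q g = k}.
Proof.
have mc : measurable (seq_cover s) by exact: measurable_seq_cover.
have fc : (sigma (seq_cover s) < +oo)%E.
  by apply: seq_cover_lty => // Q /sigmas/andP[].
have [k k0 kb] := ball_Lp_indic mc fc.
exists (fun x => k * \1_(seq_cover s) x) => //; exists k => // Q Qs.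
apply: avg_indic; [exact: ms|exact: sigmas|].
by move=> x Qx; apply/seq_coverP; exists Q.
Qed.

(** Maurey's factorization for the restricted operator: with the weight
    w = u^(q-1), Top is bounded from L^p(sigma) to L^1(w omega). *)
Let maurey : exists2 u : T -> R,
  [/\ measurable_fun setT u, forall x, 0 <= u x,
      exists2 e : R, 0 < e & forall Q x, Q \in s -> Q x -> e * lambda Q <= u x &
      (\int[omega]_x (u x `^ q)%:E <= L%:E)%E] &
  forall h, ball_Lp h ->
    (\int[omega]_x (u x `^ (q - 1) * Top h x)%:E <= (12 * L)%:E)%E.
Proof.
have [g gb [k k0 gk]] := bottom.
have [mg g0 _] := gb.
have half : 1 - 1 / 2 = 1 / 2 :> R by lra.
have h01 : 0 <= 1 / 2 :> R by lra.
have h11 : 1 / 2 <= 1 :> R by lra.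
pose mid h x := (1 - 1 / 2) * g x + 1 / 2 * h x.
have midb h : ball_Lp h -> ball_Lp (mid h) by move=> hb; exact: ball_Lp_convex.
have Tmid h x : ball_Lp h -> Top (mid h) x = 1 / 2 * Top g x + 1 / 2 * Top h x.
  by move=> hb; rewrite /mid Top_lincomb// half.
pose V : set (T -> R) := [set Top (mid h) | h in ball_Lp].
pose M := (\sum_(Q <- s) (1 + (fine (sigma Q))^-1)) / k.
have M0 : 0 <= M.
  apply: divr_ge0; last exact: ltW.
  by apply: sumr_ge0 => Q _; rewrite addr_ge0// invr_ge0 fine_ge0.
have dom h x : ball_Lp h -> Top h x <= M * Top g x.
  move=> hb; have [mh h0 _] := hb.
  rewrite /Top /stepfun big_distrr/= big_seq [leRHS]big_seq.
  apply: ler_sum => Q Qs; have /andP[Q0 Qoo] := sigmas Qs.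
  have fQ0 : 0 < fine (sigma Q) by rewrite fine_gt0// Q0.
  rewrite [leRHS]mulrA ler_wpM2r ?indic_ge0// [leRHS]mulrCA.
  rewrite ler_wpM2l ?(ltW (lambda0 Qs))//.
  rewrite gk// /M divfK ?gt_eqF// (big_rem Q)//=.
  apply: (@le_trans _ _ (1 + (fine (sigma Q))^-1)); last first.
    rewrite lerDl; apply: sumr_ge0 => P _.
    by rewrite addr_ge0// invr_ge0 fine_ge0.
  rewrite /avg ler_pdivrMr// mulrDl mul1r mulVf ?gt_eqF//.
  have := ball_Lp_integral hb (ms Qs).
  have hfin := integrable_fin_num (ms Qs) (ball_Lp_integrable hb (ms Qs) Qoo).
  have sE : (fine (sigma Q))%:E = sigma Q by rewrite fineK// ge0_fin_numE.
  by rewrite -lee_fin EFinD sE /Rintegral fineK.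
have TM u v : V u -> V v -> forall x, v x <= (1 + M) * u x.
  move=> [h1 h1b <-] [h2 h2b <-] x; rewrite !Tmid//.
  have [_ h10 _] := h1b.
  have := dom h2 x h2b; have := Top_ge0 x g0; have := Top_ge0 x h10; nra.
have Vm v : V v -> measurable_fun setT v.
  by move=> [h hb <-]; exact: measurable_Top.
have Vge0 v : V v -> forall x, 0 <= v x.
  by move=> [h hb <-] x; apply: Top_ge0; have [] := midb _ hb.
have Vconv u v (e : R) : V u -> V v -> 0 <= e -> e <= 1 ->
     V (fun x => (1 - e) * u x + e * v x).
  move=> [h1 h1b <-] [h2 h2b <-] e0 e1.
  exists (fun x => (1 - e) * h1 x + e * h2 x); first exact: ball_Lp_convex.
  have heb := ball_Lp_convex h1b h2b e0 e1.
  apply/funext => x; rewrite (Tmid _ _ h1b) (Tmid _ _ h2b) (Tmid _ _ heb).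
  by rewrite Top_lincomb//; ring.
have VL v : V v -> (\int[omega]_x (v x `^ q)%:E <= L%:E)%E.
  by move=> [h hb <-]; apply: TL; exact: midb.
have Vn : V !=set0 by exists (Top (mid g)), g.
have M1 : 0 < 1 + M by lra.
have [u Vu uV] := approximate_maximizer q0 q1 L0 M1 Vn Vm Vge0 Vconv VL TM.
have [h0 h0b uE] := Vu.
exists u.
  split; [exact: Vm|exact: Vge0| |exact: VL].
  exists (1 / 2 * k); first by rewrite mulr_gt0//; lra.
  move=> Q x Qs Qx; rewrite -uE Tmid//; have [_ h00 _] := h0b.
  have := stepfun_ge (Top_coef g0) Qs Qx; rewrite gk// -/(Top g).
  have := Top_ge0 x h00; lra.
move=> h hb; have [mh hge0 _] := hb.
have Vh : V (Top (mid h)) by exists h.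
apply: (@le_trans _ _
  (2%:E * \int[omega]_x (u x `^ (q - 1) * Top (mid h) x)%:E)%E).
  rewrite -ge0_integralZl_EFin//; last 2 first.
  - by move=> x _; rewrite lee_fin mulr_ge0 ?powR_ge0// Vge0.
  - apply/measurable_EFinP; apply: measurable_funM; last exact: measurable_Top.
    by apply: measurable_powR_comp; exact: Vm.
  apply: ge0_le_integral => //.
  - by move=> x _; rewrite lee_fin mulr_ge0 ?powR_ge0 ?Top_ge0.
  - apply/measurable_EFinP; apply: measurable_funM; last exact: measurable_Top.
    by apply: measurable_powR_comp; exact: Vm.
  - apply/measurable_EFinP; apply: measurable_funM => //.
    apply: measurable_funM; last exact: measurable_Top.
    by apply: measurable_powR_comp; exact: Vm.
  move=> x _; rewrite -EFinM lee_fin mulrCA ler_wpM2l ?powR_ge0// Tmid//.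
  have := Top_ge0 x g0; lra.
have -> : (12 * L)%:E = (2%:E * (6 * L)%:E)%E by rewrite -EFinM mulrA -natrM.
by apply: lee_wpmul2l; [rewrite lee_fin|exact: uV].
Qed.

(** The factors are b Q = 1 / <w>_Q and c Q = lambda Q <w>_Q, where
    <.>_Q is the average over Q with respect to omega and w = u^(q-1) is the
    weight given by maurey. The last estimate is then the boundedness of Top
    from L^p(sigma) to L^1(w omega). For the first one, Jensen's inequality
    bounds b Q by a power of <u^(q/2)>_Q, whence the supremum of the b Q 1_Q by a
    power of the maximal function of u^(q/2), to which the L^2 bound applies. *)
Lemma finite_factorization : exists b : set T -> R,
  [/\ {in s, forall Q, 0 < b Q},
      (\int[omega]_x (seqmax b s x `^ (q / (1 - q)))%:E <= (4 * L)%:E)%E &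
      forall h, ball_Lp h ->
        \sum_(Q <- s) lambda Q / b Q * fine (omega Q) * avg sigma Q h
          <= 12 * L].
Proof.
have [u [mu u0 [e e0 eu] uL] uT] := maurey.
pose w x := u x `^ (q - 1).
pose v x := u x `^ (q / 2).
(* the exponent for which w = v^(-a) and (m^a)^(q / (1 - q)) = m^2 *)
pose a := 2 * (1 - q) / q.
have q1' : 0 < 1 - q by rewrite subr_gt0.
have a0 : 0 < a by rewrite /a divr_gt0// mulr_gt0.
have mw : measurable_fun setT w by exact: measurable_powR_comp.
have mv : measurable_fun setT v by exact: measurable_powR_comp.
have w0 x : 0 <= w x by exact: powR_ge0.
have v0 x : 0 <= v x by exact: powR_ge0.
have wE x : w x = v x `^ (- a).
  rewrite /w /v -powRrM; congr (_ `^ _); rewrite /a; field; rewrite gt_eqF//.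
have v2 x : v x ^+ 2 = u x `^ q.
  rewrite -powR_mulrn// /v -powRrM; congr (_ `^ _); lra.
have uQ Q x : Q \in s -> Q x -> 0 < u x.
  by move=> Qs Qx; apply: lt_le_trans (eu _ _ Qs Qx); rewrite mulr_gt0 ?lambda0.
have oE Q : Q \in s -> (fine (omega Q))%:E = omega Q.
  by move=> /omegas/andP[Q0 Qoo]; rewrite fineK// ge0_fin_numE.
have o0 Q : Q \in s -> 0 < fine (omega Q).
  by move=> /omegas/andP[Q0 Qoo]; rewrite fine_gt0// Q0.
have iv Q : Q \in s -> omega.-integrable Q (EFin \o v).
  move=> Qs; have /andP[_ Qoo] := omegas Qs; have mQ := ms Qs.
  apply: ge0_integrable => //.
  apply: (@le_lt_trans _ _ (\int[omega]_(x in Q) (1 + u x `^ q)%:E)%E).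
    apply: ge0_le_integral => //.
    - by move=> x _; rewrite lee_fin.
    - by apply/measurable_EFinP; exact: measurable_funTS.
    - apply/measurable_EFinP/measurable_funTS; apply: measurable_funD => //.
      exact: measurable_powR_comp.
    - move=> x _; rewrite lee_fin -v2.
      by have := sqr_ge0 (1 - v x); have := v0 x; nra.
  have mq : measurable_fun setT (fun x => u x `^ q).
    exact: measurable_powR_comp.
  under eq_integral do rewrite EFinD.
  rewrite ge0_integralD//; last 2 first.
  - by move=> x _; rewrite lee_fin powR_ge0.
  - by apply/measurable_EFinP; exact: measurable_funTS.
  rewrite integral_cst// mul1e lte_add_pinfty//.
  apply: (@le_lt_trans _ _ L%:E); last by rewrite ltry.
  apply: le_trans uL; apply: ge0_subset_integral => //.
    exact/measurable_EFinP.
  by move=> x _; rewrite lee_fin powR_ge0.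
have iw Q : Q \in s -> omega.-integrable Q (EFin \o w).
  move=> Qs; have /andP[_ Qoo] := omegas Qs; have mQ := ms Qs.
  apply: ge0_integrable => //.
  have c0 : 0 < e * lambda Q by rewrite mulr_gt0 ?lambda0.
  apply: (@le_lt_trans _ _
    (\int[omega]_(x in Q) ((e * lambda Q) `^ (q - 1))%:E)%E).
    apply: ge0_le_integral => //.
    - by move=> x _; rewrite lee_fin.
    - by apply/measurable_EFinP; exact: measurable_funTS.
    - move=> x Qx; rewrite lee_fin /w.
      have -> : q - 1 = - (1 - q) by lra.
      have ux := uQ _ _ Qs Qx.
      rewrite !powRN lef_pV2 ?posrE ?powR_gt0//.
      apply: ge0_ler_powR; rewrite ?nnegrE; [exact: ltW|exact: ltW|exact: ltW|].
      exact: eu.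
  by rewrite integral_cst// lte_mul_pinfty// lee_fin powR_ge0.
have mean_gt0 Q : Q \in s -> 0 < avg omega Q v.
  move=> Qs; rewrite /avg divr_gt0 ?o0//.
  have c0 : 0 < e * lambda Q by rewrite mulr_gt0 ?lambda0.
  apply: (@lt_le_trans _ _ (\int[omega]_(x in Q) ((e * lambda Q) `^ (q / 2)))).
    by rewrite Rintegral_cst; [rewrite mulr_gt0 ?powR_gt0 ?o0|exact: ms].
  have /andP[_ Qoo] := omegas Qs; have mQ := ms Qs.
  apply: le_Rintegral => //; last first.
  - move=> x Qx; apply: ge0_ler_powR; rewrite ?nnegrE//.
    + by rewrite divr_ge0// ltW.
    + exact: ltW.
    + exact: eu.
  - exact: iv.
  - apply: ge0_integrable => //; first by move=> x; rewrite powR_ge0.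
    by rewrite integral_cst// lte_mul_pinfty// lee_fin powR_ge0.
have jensen Q : Q \in s -> avg omega Q v `^ (- a) <= avg omega Q w.
  move=> Qs; rewrite (_ : w = (fun x => v x `^ (- a))); last first.
    by apply/funext => x; rewrite wE.
  apply: jensen_powRN => //;
    [exact: ms|exact: omegas|exact: iv| | |exact: mean_gt0].
  - by move=> x Qx; rewrite powR_gt0// (uQ _ _ Qs Qx).
  - rewrite (_ : EFin \o _ = EFin \o w); first exact: iw.
    by apply/funext => x /=; rewrite wE.
have wmean_gt0 Q : Q \in s -> 0 < avg omega Q w.
  move=> Qs; apply: lt_le_trans (jensen _ Qs).
  by rewrite powR_gt0 ?mean_gt0.
pose b Q := (avg omega Q w)^-1.
have b0 Q : Q \in s -> 0 < b Q by move=> Qs; rewrite invr_gt0 wmean_gt0.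
have bm Q : Q \in s -> b Q <= avg omega Q v `^ a.
  move=> Qs; rewrite /b -(invrK (_ `^ a)) -powRN.
  by rewrite lef_pV2 ?posrE ?wmean_gt0 ?powR_gt0 ?mean_gt0// jensen.
exists b; split => //.
  apply: (@le_trans _ _ (4%:E * \int[omega]_x (v x ^+ 2)%:E)%E); last first.
    rewrite EFinM; apply: lee_wpmul2l; first by rewrite lee_fin.
    by under eq_integral do rewrite v2.
  pose m Q := avg omega Q v.
  have msm := measurable_seqmax m ms.
  apply: (@le_trans _ _ (\int[omega]_x (seqmax m s x ^+ 2)%:E)%E).
    apply: ge0_le_integral => //.
    - by move=> x _; rewrite lee_fin powR_ge0.
    - by apply/measurable_EFinP/measurable_powR_comp/measurable_seqmax.
    - by apply/measurable_EFinP/measurable_funX.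
    move=> x _; rewrite lee_fin.
    have -> : seqmax m s x ^+ 2 = (seqmax m s x `^ a) `^ (q / (1 - q)).
      rewrite -powR_mulrn ?seqmax_ge0// -powRrM; congr (_ `^ _).
      by rewrite /a; field; rewrite !gt_eqF.
    apply: ge0_ler_powR; rewrite ?nnegrE ?powR_ge0 ?seqmax_ge0//.
      by rewrite divr_ge0// ltW.
    apply: seqmax_le => [|Q Qs]; first exact: powR_ge0.
    rewrite indicE; have [Qx|Qx] := boolP (x \in Q); last first.
      by rewrite mulr0 powR_ge0.
    rewrite mulr1; apply: (le_trans (bm _ Qs)).
    apply: ge0_ler_powR; rewrite ?nnegrE ?seqmax_ge0//; first exact: ltW.
      by rewrite ltW// mean_gt0.
    have := seqmax_ub m x Qs; rewrite indicE Qx mulr1; exact.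
  apply: maximal_L2 => //.
  - by move=> Q Qs; rewrite ltW// mean_gt0.
  - by move=> Q /omegas/andP[].
  move=> Q Qs; rewrite -{1}(oE _ Qs) -EFinM /m /avg divfK ?gt_eqF ?o0//.
  rewrite /Rintegral fineK//; apply: integrable_fin_num; first exact: ms.
  exact: iv.
move=> h hb; rewrite -lee_fin; apply: le_trans (uT _ hb).
have [_ h0 _] := hb.
rewrite ge0_integral_mul_stepfun//; last exact: Top_coef.
rewrite le_eqVlt; apply/orP; left; apply/eqP.
rewrite -sumEFin big_seq [RHS]big_seq; apply: eq_bigr => Q Qs.
have iQ :
    (\int[omega]_(x in Q) (w x)%:E = (avg omega Q w * fine (omega Q))%:E)%E.
  rewrite /avg divfK ?gt_eqF ?o0// /Rintegral fineK//.
  by apply: integrable_fin_num; [exact: ms|exact: iw].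
rewrite -/(w _) iQ -EFinM /b invrK; congr (_%:E); ring.
Qed.

End FiniteFactorization.

(** * Exhaustion by finite families and compactness *)

Section Exhaustion.
Context (T : choiceType) (R : realType).

Definition exhausts (F : nat -> seq T) (D : set T) :=
  [/\ forall n, uniq (F n), forall n x, x \in F n -> D x,
    forall m n, (m <= n)%N -> {subset F m <= F n} &
    forall x, D x -> exists n, x \in F n].

Lemma countable_exhaustion (D : set T) : countable D ->
  exists F : nat -> seq T, exhausts F D.
Proof.
move=> /countable_injP[f finj].
pose g n := match pselect (exists x, D x /\ f x = n) with
  | left e => Some (projT1 (cid e)) | right _ => None end.
have gD n x : g n = Some x -> D x /\ f x = n.
  by rewrite /g; case: pselect => // e [<-]; case: cid.
have gf x : D x -> g (f x) = Some x.
  move=> Dx; case E: (g (f x)) => [y|].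
    have [Dy fyx] := gD _ _ E.
    by congr Some; apply: finj; rewrite ?inE.
  by move: E; rewrite /g; case: pselect => // -[]; exists x.
exists (fun n => undup (pmap g (iota 0 n))); split.
- by move=> n; exact: undup_uniq.
- move=> n x; rewrite mem_undup mem_pmap => /mapP[i _ /esym/gD[]].
  by [].
- move=> m n mn x; rewrite !mem_undup !mem_pmap => /mapP[i].
  rewrite mem_iota => /andP[_ im] ->; apply: map_f.
  by rewrite mem_iota/= (leq_trans im).
- move=> x Dx; exists (f x).+1; rewrite mem_undup mem_pmap.
  by rewrite -(gf _ Dx); apply: map_f; rewrite mem_iota/= add0n.
Qed.

Lemma exhausts_seq (F : nat -> seq T) D (s : seq T) : exhausts F D ->
  (forall x, x \in s -> D x) -> exists n, {subset s <= F n}.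
Proof.
move=> [_ FD Fm FE]; elim: s => [|x s IH] sD; first by exists 0%N.
have [y ys|n sn] := IH; first by apply: sD; rewrite inE ys orbT.
have [k xk] := FE x (sD _ (mem_head _ _)).
exists (maxn n k) => y; rewrite inE => /predU1P[->|/sn].
  exact: (Fm k _ (leq_maxr _ _)).
exact: (Fm n _ (leq_maxl _ _)).
Qed.

Lemma le_sum_subset (s r : seq T) (a : T -> \bar R) : uniq s -> uniq r ->
  {subset s <= r} -> (forall x, x \in r -> 0 <= a x)%E ->
  (\sum_(x <- s) a x <= \sum_(x <- r) a x)%E.
Proof.
move=> us ur sr a0.
have -> : (\sum_(x <- s) a x = \sum_(x <- r | x \in s) a x)%E.
  rewrite -[RHS]big_filter; apply: perm_big; apply: uniq_perm => //.
    exact: filter_uniq.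
  by move=> x; rewrite mem_filter andb_idr// => /sr.
rewrite [leRHS](bigID (mem s))/= leeDl//.
by rewrite big_seq_cond sume_ge0// => x /andP[xr _]; exact: a0.
Qed.

Lemma fsum_seq (A : set T) (r : seq T) (a : T -> \bar R) : uniq r ->
  (forall x, A x <-> x \in r) ->
  (\sum_(x \in A) a x = \sum_(x <- r) a x)%E.
Proof.
move=> ur Ar; rewrite (fsbigE r)//.
- rewrite big_seq_cond [RHS]big_seq_cond; apply: eq_bigl => x.
  by case: (boolP (x \in r)) => //= xr; rewrite mem_set//; apply/Ar.
- by move=> x /= /Ar.
- by move=> x /Ar ->.
Qed.

Lemma esum_exhausts (F : nat -> seq T) D (a : T -> \bar R) : exhausts F D ->
  (forall x, D x -> 0 <= a x)%E ->
  (\esum_(x in D) a x)%E =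
    ereal_sup (range (fun n => \sum_(x <- F n) a x)%E).
Proof.
move=> FD a0; have [uF FsD Fm FE] := FD.
apply/eqP; rewrite eq_le; apply/andP; split.
  apply: ge_ereal_sup => _ [A [finA AD] <-].
  have [s sA] := (finite_seqP A).1 finA.
  have sD x : x \in undup s -> D x.
    by rewrite mem_undup => xs; apply: AD; rewrite sA.
  have [n sn] := exhausts_seq FD sD.
  rewrite (_ : (\sum_(x \in A) a x)%E = (\sum_(x <- undup s) a x)%E);
    last first.
    by apply: fsum_seq => [|x]; [exact: undup_uniq|rewrite mem_undup sA].
  apply: le_trans (ereal_sup_ubound _); last by exists n.
  apply: le_sum_subset => //; first exact: undup_uniq.
  by move=> x /FsD; exact: a0.
apply: ge_ereal_sup => _ [n _ <-].
apply: ereal_sup_ubound; exists [set` F n].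
  by split; [exact: finite_seq|move=> x /= /FsD].
exact: fsum_seq.
Qed.

Lemma ultra_fmap (I J : Type) (f : I -> J) (U : set_system I) :
  UltraFilter U -> UltraFilter (fmap f U).
Proof.
move=> UU; apply: Build_UltraFilter => G GP sG.
apply/seteqP; split => // A GA.
have [//|UnA] := in_ultra_setVsetC (f @^-1` A) UU.
have GnA : G (~` A) by apply: sG.
by have [z []] := filter_ex (filterI GA GnA).
Qed.

(** A diagonal extraction. The limits y i of the bounded sequences x ^~ i along
    one ultrafilter exist for all i at once; being positive, they are within a
    factor 2 of x n i for suitable n, simultaneously for finitely many i. *)
Lemma ultrafilter_selection (D : set T) (x : nat -> T -> R) (lo hi : T -> R) :
  (forall i, D i -> 0 < lo i) ->
  (forall i, D i -> \forall n \near \oo, lo i <= x n i <= hi i) ->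
  exists2 y : T -> R, forall i, D i -> 0 < y i &
    forall (s : seq T) m, (forall i, i \in s -> D i) ->
      exists2 n, (m <= n)%N & forall i, i \in s ->
        y i <= 2 * x n i /\ x n i <= 2 * y i.
Proof.
move=> lo0 xlh.
have [U [UU subU]] := @ultraFilterLemma _ _ eventually_filter.
have UP : ProperFilter U by exact: ultra_proper.
have cv i : exists y, D i -> lo i <= y /\ (x n i @[n --> U] --> y).
  have [Di|nDi] := pselect (D i); last by exists 0.
  have cpt := @segment_compact R (lo i) (hi i); rewrite compact_ultra in cpt.
  have [|y [/=]] := cpt (fmap (fun n => x n i) U) (ultra_fmap _ UU).
    rewrite /fmap /=; have := subU _ (xlh i Di).
    by apply: filterS => n; rewrite /= in_itv.
  rewrite in_itv/= => /andP[loy _] cy.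
  by exists y.
have [y yP] := choice cv.
exists y.
  by move=> i Di; have [loy _] := yP i Di; exact: lt_le_trans (lo0 _ Di) loy.
move=> s m sD.
have H : \forall n \near U, forall i, i \in s ->
    y i <= 2 * x n i /\ x n i <= 2 * y i.
  elim: s sD => [|i s IH] sD; first by apply: nearW.
  have Di := sD _ (mem_head _ _).
  have [loy cy] := yP i Di.
  have y0 : 0 < y i := lt_le_trans (lo0 _ Di) loy.
  have sD' j : j \in s -> D j by move=> js; apply: sD; rewrite inE js orbT.
  have {}IH := IH sD'.
  near=> n => j; rewrite inE => /predU1P[->|js]; last by move: j js; near: n.
  split.
    have : y i / 2 < x n i by near: n; apply: (cvgr_gt _ cy); lra.
    lra.
  by apply: ltW; near: n; apply: (cvgr_lt _ cy); lra.
have M : \forall n \near U, (m <= n)%N by apply: subU; exact: nbhs_infty_ge.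
have [n [h1 h2]] := filter_ex (filterI H M).
by exists n.
Unshelve. all: by end_near. Qed.

End Exhaustion.

(** * Monotone limits and duality *)

Section Limits.
Context d (T : measurableType d) (R : realType).
Variable mu : {measure set T -> \bar R}.

Lemma le_poweR (x y : \bar R) (r : R) : 0 <= r -> (0 <= x)%E -> (x <= y)%E ->
  (x `^ r <= y `^ r)%E.
Proof.
move=> r0 x0 xy; apply: gt0_ler_poweR => //; rewrite in_itv/= leey andbT//.
exact: le_trans xy.
Qed.

Lemma poweRK (x : \bar R) (r : R) : r != 0 -> (0 <= x)%E ->
  ((x `^ r) `^ r^-1 = x)%E.
Proof. by move=> r0 x0; rewrite -poweRrM mulfV// poweRe1. Qed.

Lemma poweRVK (x : \bar R) (r : R) : r != 0 -> (0 <= x)%E ->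
  ((x `^ r^-1) `^ r = x)%E.
Proof. by move=> r0 x0; rewrite -poweRrM mulVf// poweRe1. Qed.

Lemma integral_sup_powR (g : nat -> T -> R) (r : R) (K : \bar R) : 0 < r ->
  (forall n, measurable_fun setT (g n)) -> (forall n x, 0 <= g n x) ->
  (forall m n x, (m <= n)%N -> g m x <= g n x) ->
  (forall n, (\int[mu]_x (g n x `^ r)%:E <= K)%E) ->
  (\int[mu]_x (ereal_sup (range (fun n => (g n x)%:E)) `^ r) <= K)%E.
Proof.
move=> r0 mg g0 gm gK.
have rn0 : r != 0 by rewrite gt_eqF.
pose gr n x := ((g n x `^ r)%:E : \bar R).
have grm x m n : (m <= n)%N -> (gr m x <= gr n x)%E.
  by move=> mn; rewrite lee_fin ge0_ler_powR ?nnegrE ?gm// ltW.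
have gr0 n x : (0 <= gr n x)%E by rewrite lee_fin powR_ge0.
have mgr n : measurable_fun setT (gr n).
  by apply/measurable_EFinP; exact: measurable_powR_comp.
have limE x : limn (gr^~ x) = (ereal_sup (range (fun n => (g n x)%:E)) `^ r)%E.
  have /cvg_lim -> // := @ereal_nondecreasing_cvgn _ (gr^~ x) (grm x).
  set G := ereal_sup (range (fun n => (g n x)%:E)).
  have gG n : ((g n x)%:E <= G)%E by apply: ereal_sup_ubound; exists n.
  have G0 : (0 <= G)%E by apply: le_trans (gG 0%N); rewrite lee_fin.
  set P := ereal_sup _.
  have gP n : (gr n x <= P)%E by apply: ereal_sup_ubound; exists n.
  have P0 : (0 <= P)%E by apply: le_trans (gP 0%N).
  apply/eqP; rewrite eq_le; apply/andP; split.
    apply: ge_ereal_sup => _ [n _ <-].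
    rewrite /gr -poweR_EFin; apply: le_poweR; [exact: ltW|by rewrite lee_fin|].
    exact: gG.
  rewrite -[leRHS](poweRVK rn0 P0); apply: le_poweR; [exact: ltW|by []|].
  apply: ge_ereal_sup => _ [n _ <-].
  rewrite -[leLHS](poweRK rn0); last by rewrite lee_fin.
  apply: le_poweR; [by rewrite invr_ge0 ltW|exact: poweR_ge0|].
  by rewrite poweR_EFin; exact: gP.
under eq_integral do rewrite -limE.
have cvg := @cvg_monotone_convergence _ _ _ mu _ measurableT gr mgr
  (fun n x _ => gr0 n x) (fun x _ => grm x).
rewrite -(cvg_lim _ cvg)//; apply: lime_le.
  by apply/cvg_ex; eexists; exact: cvg.
exact: nearW.
Qed.

Lemma hoelder_conjugate_gt1 (p : R) : 1 < p ->
  hoelder_conjugate p%:E = (p / (p - 1))%:E.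
Proof.
move=> p1; rewrite /hoelder_conjugate/= eqe gt_eqF ?(lt_trans ltr01)//=.
by rewrite -EFinB inver subr_eq0 gt_eqF// EFinM.
Qed.

(** If S exceeded some K + e on a set A of positive measure, then the normalized
    indicator of A would contradict the hypothesis. *)
Lemma Linfty_duality (S : T -> R) (E : set T) (B K : R) :
  measurable_fun setT S -> (forall x, 0 <= S x) ->
  measurable E -> (mu E < +oo)%E -> (forall x, S x <= B * \1_E x) -> 0 < K ->
  (forall h, ball_Lp mu 1 h -> (\int[mu]_x (h x * S x)%:E <= K%:E)%E) ->
  ('N[mu]_(+oo)[EFin \o S] <= K%:E)%E.
Proof.
move=> mS S0 mE fE SB K0 h.
have SabsE x : `|S x| = S x by rewrite ger0_norm.
have SE0 x : ~ E x -> S x = 0.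
  move=> nE; apply/eqP; rewrite eq_le S0 andbT (le_trans (SB x))//.
  by rewrite indicE memNset// mulr0.
rewrite unlock; case: ifPn => _; last by rewrite lee_fin ltW.
apply/lee_addgt0Pr => e e0; apply/ess_supP.
pose A := [set x | K + e <= S x].
have mA : measurable A.
  have mS' : measurable_fun setT (EFin \o S) by exact/measurable_EFinP.
  have := emeasurable_fun_c_infty measurableT mS' (K + e)%:E.
  by rewrite setTI.
have AE : A `<=` E.
  move=> x Ax; apply: contrapT => /SE0 Sx.
  by move: Ax; rewrite /A /= Sx leNgt addr_gt0.
have fA : (mu A < +oo)%E.
  by apply: le_lt_trans fE; apply: le_measure => //; exact: mem_set.
have muA0 : mu A = 0%E.
  apply/eqP; rewrite eq_le measure_ge0 andbT leNgt; apply/negP => A0.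
  have fA0 : 0 < fine (mu A) by rewrite fine_gt0// A0.
  have AfE : mu A = (fine (mu A))%:E by rewrite fineK// ge0_fin_numE.
  have mi : measurable_fun setT (\1_A : T -> R) by exact: measurable_indic.
  pose k := (fine (mu A))^-1.
  have k0 : 0 < k by rewrite invr_gt0.
  have hb : ball_Lp mu 1 (fun x => k * \1_A x).
    have kA0 x : 0 <= k * \1_A x by rewrite mulr_ge0 ?indic_ge0// ltW.
    split=> //; first exact: measurable_funM.
    rewrite (_ : (fun x => _) = fun x => (k%:E * (\1_A x)%:E)%E); last first.
      by apply/funext => x; rewrite powRr1// EFinM.
    rewrite ge0_integralZl_EFin ?(ltW k0)//; do ?[exact/measurable_EFinP].
    by rewrite integral_indic// setIT AfE -EFinM mulVf// gt_eqF.
  have := h _ hb; apply/negP; rewrite -ltNge.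
  apply: (@lt_le_trans _ _ (\int[mu]_x ((k * (K + e)) * \1_A x)%:E)%E).
    under eq_integral do rewrite EFinM.
    rewrite ge0_integralZl_EFin; last 4 first.
    + exact: measurableT.
    + by move=> x _; rewrite lee_fin indic_ge0.
    + exact/measurable_EFinP.
    + by rewrite mulr_ge0 ?(ltW k0)//; lra.
    rewrite integral_indic// setIT AfE -EFinM lte_fin.
    rewrite mulrAC mulVf ?gt_eqF//; lra.
  apply: ge0_le_integral => //.
  - move=> x _; rewrite lee_fin mulr_ge0 ?indic_ge0//.
    by rewrite mulr_ge0 ?(ltW k0)//; lra.
  - by apply/measurable_EFinP; exact: measurable_funM.
  - apply/measurable_EFinP; apply: measurable_funM => //.
    exact: measurable_funM.
  move=> x _; rewrite lee_fin indicE; case: (boolP (x \in A)) => [|_] /=.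
    by rewrite inE => Ax; rewrite !mulr1 ler_wpM2l// ltW.
  by rewrite !mulr0 mul0r.
exists A; split => //= x /= /negP; rewrite -ltNge -EFinD lte_fin SabsE => Sx.
exact: ltW.
Qed.

(** The test function S^(p' - 1), normalized in L^p, turns the pairing with S
    into the norm of S in L^p'. This norm is finite as S is bounded by a multiple
    of the indicator of a set of finite measure. *)
Lemma Lnorm_duality_gt1 (p : R) (S : T -> R) (E : set T) (B K : R) : 1 < p ->
  measurable_fun setT S -> (forall x, 0 <= S x) ->
  measurable E -> (mu E < +oo)%E -> (forall x, S x <= B * \1_E x) -> 0 < K ->
  (forall h, ball_Lp mu p h -> (\int[mu]_x (h x * S x)%:E <= K%:E)%E) ->
  ('N[mu]_(hoelder_conjugate p%:E)[EFin \o S] <= K%:E)%E.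
Proof.
move=> p1 mS S0 mE fE SB K0 h.
have SabsE x : `|S x| = S x by rewrite ger0_norm.
have SE0 x : ~ E x -> S x = 0.
  move=> nE; apply/eqP; rewrite eq_le S0 andbT (le_trans (SB x))//.
  by rewrite indicE memNset// mulr0.
have pm1 : 0 < p - 1 by rewrite subr_gt0.
have p0 : 0 < p by exact: lt_trans p1.
rewrite hoelder_conjugate_gt1//; set r := p / (p - 1).
have r0 : 0 < r by rewrite divr_gt0.
have rn0 : r != 0 by rewrite gt_eqF.
have mSr (k : R) : measurable_fun setT (fun x => S x `^ k).
  exact: measurable_powR_comp.
rewrite unlock; under eq_integral do rewrite /= SabsE.
set I := (\int[mu]_x (S x `^ r)%:E)%E.
have I0 : (0 <= I)%E by apply: integral_ge0 => x _; rewrite lee_fin powR_ge0.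
have mi : measurable_fun setT (\1_E : T -> R) by exact: measurable_indic.
have Ifin : (I < +oo)%E.
  apply: (@le_lt_trans _ _ (\int[mu]_x (`|B| `^ r * \1_E x)%:E)%E).
    apply: ge0_le_integral => //.
    - by move=> x _; rewrite lee_fin powR_ge0.
    - exact/measurable_EFinP.
    - by apply/measurable_EFinP; exact: measurable_funM.
    move=> x _; rewrite lee_fin; have [Ex|Ex] := pselect (E x).
      rewrite indicE mem_set// mulr1 ge0_ler_powR ?nnegrE ?(ltW r0)//.
      by apply: le_trans (SB x) _; rewrite indicE mem_set// mulr1 ler_norm.
    by rewrite SE0// powR0// mulr_ge0 ?powR_ge0 ?indic_ge0.
  under eq_integral do rewrite EFinM.
  rewrite ge0_integralZl_EFin ?powR_ge0//; do ?[exact/measurable_EFinP].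
  by rewrite integral_indic// setIT lte_mul_pinfty// lee_fin powR_ge0.
have [Iz|In0] := eqVneq I 0%E.
  by rewrite Iz poweR0r ?invr_eq0// lee_fin ltW.
have IE : I = (fine I)%:E by rewrite fineK// ge0_fin_numE.
have i0 : 0 < fine I by rewrite fine_gt0// Ifin lt0e In0 I0.
set i := fine I in IE i0.
pose k := i `^ (- p^-1).
have k0 : 0 < k by rewrite powR_gt0.
have hb : ball_Lp mu p (fun x => k * S x `^ (r - 1)).
  split; [exact: measurable_funM|by move=> x; rewrite mulr_ge0 ?powR_ge0|].
  rewrite (_ : (fun x => _) = (fun x => (i^-1 * S x `^ r)%:E)); last first.
    apply/funext => x; rewrite powRM ?powR_ge0// /k -!powRrM.
    rewrite mulNr mulVf ?gt_eqF//.
    rewrite powR_inv1 ?(ltW i0)//; congr (_ * (_ `^ _))%:E.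
    by rewrite /r; field; rewrite gt_eqF.
  under eq_integral do rewrite EFinM.
  rewrite ge0_integralZl_EFin//; do ?[by move=> x _; rewrite lee_fin powR_ge0
    |exact/measurable_EFinP|by rewrite invr_ge0 ltW].
  by rewrite -/I IE -EFinM mulVf// gt_eqF.
have := h _ hb.
rewrite (_ : (fun x => _) = (fun x => (k * S x `^ r)%:E)); last first.
  apply/funext => x; rewrite -mulrA [X in k * X]mulrC mulr_powRB1//.
under eq_integral do rewrite EFinM.
rewrite ge0_integralZl_EFin//; do ?[by move=> x _; rewrite lee_fin powR_ge0
  |exact/measurable_EFinP|exact: ltW].
rewrite -/I IE -EFinM poweR_EFin !lee_fin; apply: le_trans.
rewrite /k -[X in _ * X](powRr1 (ltW i0)) -powRD; last first.
  by rewrite (gt_eqF i0) implybT.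
rewrite le_eqVlt; apply/orP; left; apply/eqP; congr (_ `^ _).
by rewrite /r; field; rewrite !gt_eqF.
Qed.

Lemma Lnorm_duality (p : R) (S : T -> R) (E : set T) (B K : R) : 1 <= p ->
  measurable_fun setT S -> (forall x, 0 <= S x) ->
  measurable E -> (mu E < +oo)%E -> (forall x, S x <= B * \1_E x) -> 0 < K ->
  (forall h, ball_Lp mu p h -> (\int[mu]_x (h x * S x)%:E <= K%:E)%E) ->
  ('N[mu]_(hoelder_conjugate p%:E)[EFin \o S] <= K%:E)%E.
Proof.
rewrite le_eqVlt => /predU1P[<-|]; last exact: Lnorm_duality_gt1.
rewrite hoelder_conjugate1; exact: Linfty_duality.
Qed.

(** The Fatou property of the norm along increasing sequences. *)
Lemma Lnorm_sup (p : R) (g : nat -> T -> R) (K : R) : 1 <= p -> 0 <= K ->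
  (forall n, measurable_fun setT (g n)) -> (forall n x, 0 <= g n x) ->
  (forall m n x, (m <= n)%N -> g m x <= g n x) ->
  (forall n, 'N[mu]_(hoelder_conjugate p%:E)[EFin \o g n] <= K%:E)%E ->
  ('N[mu]_(hoelder_conjugate p%:E)[
     (fun x => ereal_sup (range (fun n => (g n x)%:E)))] <= K%:E)%E.
Proof.
move=> p1 K0 mg g0 gm gK.
have G0 x : (0 <= ereal_sup (range (fun n => (g n x)%:E)))%E.
  by apply: le_trans (ereal_sup_ubound _); [|exists 0%N => //]; rewrite lee_fin.
move: p1; rewrite le_eqVlt => /predU1P[p1|p1].
  move: gK; rewrite -p1 hoelder_conjugate1 unlock.
  case: ifPn => _ gK; last by rewrite lee_fin.
  apply/ess_supP.
  have H : \forall x \ae mu, forall n, (`|(g n x)%:E| <= K%:E)%E.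
    by apply/ae_foralln => n; apply/ess_supP; exact: gK.
  apply: filterS H => x Hx /=; rewrite gee0_abs//.
  apply: ge_ereal_sup => _ [n _ <-]; apply: le_trans (Hx n).
  by rewrite lee_fin ler_norm.
have pm1 : 0 < p - 1 by rewrite subr_gt0.
have p0 : 0 < p by exact: lt_trans p1.
move: gK; rewrite hoelder_conjugate_gt1//; set r := p / (p - 1) => gK.
have r0 : 0 < r by rewrite divr_gt0.
have rn0 : r != 0 by rewrite gt_eqF.
have gK' n : (\int[mu]_x (g n x `^ r)%:E <= K%:E `^ r)%E.
  apply: le_trans (le_poweR (ltW r0) (Lnorm_ge0 _ _ _) (gK n)).
  rewrite poweR_Lnorm// le_eqVlt; apply/orP; left; apply/eqP.
  apply: eq_integral => x _.
  by rewrite /= ger0_norm.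
rewrite unlock; under eq_integral => x _ do rewrite (gee0_abs (G0 x)).
rewrite -[leRHS](@poweRK _ r)//; apply: le_poweR.
- by rewrite invr_ge0 ltW.
- by apply: integral_ge0 => x _; exact: poweR_ge0.
exact: integral_sup_powR.
Qed.

End Limits.

(** * Hoelder's inequality *)

Section Hoelder.
Context d (T : measurableType d) (R : realType).
Variable mu : {measure set T -> \bar R}.

Lemma hoelder_lt1 (q : R) (B G : T -> R) : 0 < q -> q < 1 ->
  measurable_fun setT B -> measurable_fun setT G ->
  (forall x, 0 <= B x) -> (forall x, 0 <= G x) ->
  (\int[mu]_x ((B x * G x) `^ q)%:E <=
   (\int[mu]_x (B x `^ (q / (1 - q)))%:E) `^ (1 - q) *
   (\int[mu]_x (G x)%:E) `^ q)%E.
Proof.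
move=> q0 q1 mB mG B0 G0.
have q1' : 0 < 1 - q by rewrite subr_gt0.
have := @hoelder _ T R mu (fun x => B x `^ q) (fun x => G x `^ q)
  (1 - q)^-1 q^-1.
rewrite !invr_gt0 !invrK subrK => /(_ _ _ q1' q0 erefl) h.
have := h (measurable_powR_comp q mB) (measurable_powR_comp q mG).
rewrite Lnorm1 unlock /= !invrK.
under eq_integral do rewrite ger0_norm ?mulr_ge0 ?powR_ge0// -powRM//.
under [X in (_ <= X `^ _ * _)%E -> _]eq_integral do
  rewrite ger0_norm ?powR_ge0// -powRrM.
under [X in (_ <= _ * X `^ _)%E -> _]eq_integral do
  rewrite ger0_norm ?powR_ge0// -powRrM mulfV ?gt_eqF// powRr1//.
by [].
Qed.

(** For p = 1 the conjugate norm is an essential supremum; the bound C makes it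
    finite. *)
Lemma hoelder_conj (p C : R) (f S : T -> R) : 1 <= p ->
  measurable_fun setT f -> measurable_fun setT S ->
  (forall x, 0 <= f x) -> (forall x, 0 <= S x <= C) ->
  (\int[mu]_x (f x * S x)%:E <=
   'N[mu]_(p%:E)[EFin \o f] * 'N[mu]_(hoelder_conjugate p%:E)[EFin \o S])%E.
Proof.
move=> p1 mf mS f0 S0C.
have S0 x : 0 <= S x by have /andP[] := S0C x.
have N1E : (\int[mu]_x (f x * S x)%:E = 'N[mu]_1[EFin \o (f \* S)%R])%E.
  rewrite Lnorm1; apply: eq_integral => x _ /=.
  by rewrite ger0_norm// mulr_ge0.
move: p1; rewrite le_eqVlt => /predU1P[p1|p1]; last first.
  have pm1 : 0 < p - 1 by rewrite subr_gt0.
  have p0 : 0 < p by rewrite (lt_trans ltr01).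
  rewrite N1E hoelder_conjugate_gt1//; apply: hoelder => //.
    by rewrite divr_gt0.
  by field; rewrite !gt_eqF.
rewrite -p1 hoelder_conjugate1.
have [T0|T0] := eqVneq (mu setT) 0%E.
  have mfS : measurable_fun setT (fun x => (f x * S x)%:E).
    by apply/measurable_EFinP; exact: measurable_funM.
  rewrite (null_set_integral measurableT mfS T0).
  by apply: mule_ge0; exact: Lnorm_ge0.
have NSE :
    ('N[mu]_(+oo)[EFin \o S] = ess_sup mu (abse \o (EFin \o S)))%E.
  by rewrite unlock lt0e T0 measure_ge0.
have NSle : ('N[mu]_(+oo)[EFin \o S] <= C%:E)%E.
  rewrite NSE; apply/ess_supP; apply: nearW => x /=.
  by rewrite lee_fin ger0_norm//; have /andP[] := S0C x.
have NSge : (0 <= 'N[mu]_(+oo)[EFin \o S])%E by exact: Lnorm_ge0.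
pose e := fine ('N[mu]_(+oo)[EFin \o S])%E.
have eE : ('N[mu]_(+oo)[EFin \o S] = e%:E)%E.
  by rewrite fineK// ge0_fin_numE// (le_lt_trans NSle)// ltry.
have e0 : 0 <= e by rewrite fine_ge0.
have H : \forall x \ae mu, (`|(S x)%:E| <= e%:E)%E.
  by rewrite -eE NSE; exact: ess_sup_ge.
rewrite eE Lnorm1.
under [X in (_ <= X * _)%E]eq_integral do rewrite /= ger0_norm//.
rewrite muleC -ge0_integralZl_EFin//; do ?[exact/measurable_EFinP
  |by move=> x _; rewrite lee_fin].
apply: ae_ge0_le_integral => //.
- by move=> x _; rewrite lee_fin mulr_ge0.
- by apply/measurable_EFinP; exact: measurable_funM.
- by move=> x _; rewrite -EFinM lee_fin mulr_ge0.
- by apply/measurable_EFinP; exact: measurable_funM.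
apply: filterS H => x; rewrite /= ger0_norm// lee_fin => Sx _.
by rewrite -EFinM lee_fin mulrC ler_wpM2r.
Qed.

End Hoelder.

(** * Dyadic cubes *)

Section DyadicCubes.
Context (R : realType) (d : nat).
Local Notation Rd := (borelRd R d).

Lemma dyadic_cubeP (k : int) (j : 'rV[int]_d) (x : 'rV[R]_d) :
  dyadic_cube k j x <-> forall i : 'I_d,
    (2 : R) ^ k * (j ord0 i)%:~R <= x ord0 i
      < (2 : R) ^ k * ((j ord0 i)%:~R + 1).
Proof.
have k0 : 0 < (2 : R) ^ k by exact: exprz_gt0.
split.
  move=> [y /= y01 <-] i; have /andP[y0 y1] := y01 i.
  rewrite !mxE ler_pM2l// ltr_pM2l//.
  by rewrite [X in X < _]addrC lerDr y0 ltrD2l.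
move=> h; exists ((2 : R) ^ (- k) *: x - map_mx intr j).
  move=> i; have /andP[h1 h2] := h i.
  rewrite !mxE subr_ge0 ltrBlDl -invr_expz.
  by rewrite [X in _ <= X]mulrC ler_pdivlMr// [X in X < _]mulrC ltr_pdivrMr//
    mulrC h1 [X in _ < X]mulrC h2.
by rewrite subrK scalerA -invr_expz mulfV ?scale1r// gt_eqF.
Qed.

Lemma measurable_coord (i : 'I_d) (a : R) :
  measurable ([set x : 'rV[R]_d | x ord0 i < a] : set Rd).
Proof.
apply: sub_sigma_algebra.
rewrite (_ : [set _ | _] =
  (fun x : 'rV[R]_d => x ord0 i) @^-1` [set y | y < a])//.
apply: open_comp => [x _|]; first exact: coord_continuous.
exact: open_lt.
Qed.

Lemma measurable_dyadic (Q : set Rd) : dyadic Q -> measurable Q.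
Proof.
move=> [k [j ->]].
pose lo (i : 'I_d) : R := (2 : R) ^ k * (j ord0 i)%:~R.
pose hi (i : 'I_d) : R := (2 : R) ^ k * ((j ord0 i)%:~R + 1).
rewrite (_ : dyadic_cube k j = \bigcap_(i in [set: 'I_d])
  ([set x : 'rV[R]_d | x ord0 i < hi i] `\` [set x | x ord0 i < lo i])).
  apply: fin_bigcap_measurable => // i _.
  by apply: measurableD; exact: measurable_coord.
apply/seteqP; split => x.
  move=> /dyadic_cubeP h i _; have /andP[h1 h2] := h i.
  by split => //=; apply/negP; rewrite -leNgt.
move=> h; apply/dyadic_cubeP => i; have [/= h1 /negP] := h i I.
by rewrite -leNgt => h2; rewrite h1 andbT.
Qed.

Lemma locally_finite_compact (mu : {measure set Rd -> \bar R})
    (K A : set 'rV[R]_d) :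
  locally_finite mu -> compact K -> A `<=` K -> measurable (A : set Rd) ->
  (mu A < +oo)%E.
Proof.
move=> lf; rewrite compact_cover => Kc AK mA.
have [U UP] := choice lf.
have [||F _ FK] := Kc 'rV[R]_d setT U.
- by move=> x _; have [[]] := UP x.
- by move=> x Kx; exists x => //; have [[]] := UP x.
pose s : seq (set Rd) := map U (finmap.enum_fset F).
have mU x : measurable (U x : set Rd).
  by apply: sub_sigma_algebra; have [[]] := UP x.
have ms : {in s, forall Q, measurable Q} by move=> _ /mapP[x _ ->].
have fs : {in s, forall Q, (mu Q < +oo)%E}.
  by move=> _ /mapP[x _ ->]; have [] := UP x.
apply: le_lt_trans (seq_cover_lty ms fs).
apply: le_measure; [exact: mem_set| |].
  by apply: mem_set; exact: measurable_seq_cover.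
move=> x /AK /FK [y /= yF Ux]; apply/seq_coverP; exists (U y) => //.
exact: map_f.
Qed.

Lemma dyadic_lty (mu : {measure set Rd -> \bar R}) (Q : set Rd) :
  locally_finite mu -> dyadic Q -> (mu Q < +oo)%E.
Proof.
move=> lf dQ; have mQ := measurable_dyadic dQ; have [k [j QE]] := dQ.
pose lo (i : 'I_d) : R := (2 : R) ^ k * (j ord0 i)%:~R.
pose hi (i : 'I_d) : R := (2 : R) ^ k * ((j ord0 i)%:~R + 1).
apply: (@locally_finite_compact mu
  [set x | forall i, `[lo i, hi i]%classic (x ord0 i)]) => //.
  apply: (@rV_compact R d (fun i => `[lo i, hi i]%classic)) => i.
  exact: segment_compact.
rewrite QE => x /dyadic_cubeP h i; have /andP[h1 h2] := h i.
by rewrite /= in_itv/= h1 ltW.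
Qed.

Lemma dyadic_subset (k : int) (n : nat) (j j' : 'rV[int]_d) (x : 'rV[R]_d) :
  dyadic_cube k j x -> dyadic_cube (k + n%:Z) j' x ->
  @dyadic_cube R d k j `<=` dyadic_cube (k + n%:Z) j'.
Proof.
move=> /dyadic_cubeP xj /dyadic_cubeP xj' y /dyadic_cubeP yj.
apply/dyadic_cubeP => i.
have /andP[a1 a2] := xj i; have /andP[b1 b2] := xj' i.
have /andP[c1 c2] := yj i.
have k0 : 0 < (2 : R) ^ k by exact: exprz_gt0.
(* every inequality then becomes one between integers, in units of 2 ^ k *)
have E z : (2 : R) ^ (k + n%:Z) * z%:~R = 2 ^ k * ((2 ^+ n * z)%R : int)%:~R.
  by rewrite expfzDr// -mulrA intrM rmorphXn.
move: b1 b2; rewrite -[1]/(1%:~R) -!intrD !E => b1 b2.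
move: a2 c2; rewrite -[1]/(1%:~R) -!intrD => a2 c2.
have h1 : 2 ^+ n * j' ord0 i <= j ord0 i.
  rewrite -ltzD1; have := le_lt_trans b1 a2.
  by rewrite ltr_pM2l// ltr_int addrC.
have h2 : j ord0 i + 1 <= 2 ^+ n * (j' ord0 i + 1).
  rewrite -ltzD1 ltrD2r; have := le_lt_trans a1 b2.
  by rewrite ltr_pM2l// ltr_int.
rewrite (le_trans _ c1) ?(lt_le_trans c2)//.
  by rewrite ler_pM2l// ler_int.
by rewrite ler_pM2l// ler_int.
Qed.

Lemma nested_dyadic (P Q : set Rd) : dyadic P -> dyadic Q -> nested P Q.
Proof.
move=> [k [j ->]] [k' [j' ->]].
have [[x [xP xQ]]|PQ] :=
  pselect (exists x : 'rV[R]_d, dyadic_cube k j x /\ dyadic_cube k' j' x);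
  last first.
  by apply: Or33; rewrite -subset0 => x [xP xQ]; apply: PQ; exists x.
have [kk|kk] := leP k k'.
  apply: Or31; move: xQ; have -> : k' = k + `|k' - k|%N%:Z.
    by rewrite gez0_abs ?subr_ge0// subrKC.
  by move=> xQ; exact: dyadic_subset xP xQ.
apply: Or32; move: xP; have -> : k = k' + `|k - k'|%N%:Z.
  by rewrite gez0_abs ?subr_ge0 ?(ltW kk)// subrKC.
by move=> xP; exact: dyadic_subset xQ xP.
Qed.

Lemma countable_dyadic : countable (@dyadic R d).
Proof.
pose f (kj : int * 'rV[int]_d) : set Rd := @dyadic_cube R d kj.1 kj.2.
rewrite (_ : @dyadic R d = f @` setT).
  by apply: card_le_trans (card_image_le _ _) _; exact: countableP.
apply/seteqP; split => Q; first by move=> [k [j ->]]; exists (k, j).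
by move=> [[k j] _ <-]; exists k, j.
Qed.

End DyadicCubes.

(** * Sums and suprema over an exhausted family *)

Section SupFormulas.
Context d (T : measurableType d) (R : realType).
Variables (F : nat -> seq (set T)) (D : set (set T)).
Hypothesis FD : exhausts F D.

Definition nat_sup (g : nat -> T -> R) (x : T) : \bar R :=
  ereal_sup (range (fun n => (g n x)%:E)).

Lemma nat_sup_ub (g : nat -> T -> R) n x : ((g n x)%:E <= nat_sup g x)%E.
Proof. by apply: ereal_sup_ubound; exists n. Qed.

Lemma nat_sup_ge0 (g : nat -> T -> R) x :
  (forall n, 0 <= g n x) -> (0 <= nat_sup g x)%E.
Proof. by move=> g0; apply: le_trans (nat_sup_ub g 0%N x); rewrite lee_fin. Qed.

Lemma measurable_nat_sup (g : nat -> T -> R) :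
  (forall n, measurable_fun setT (g n)) ->
  (forall m n x, (m <= n)%N -> g m x <= g n x) ->
  measurable_fun setT (nat_sup g).
Proof.
move=> mg gm; apply: (emeasurable_fun_cvg (fun n x => (g n x)%:E)).
  by move=> n; exact/measurable_EFinP.
move=> x _; apply: ereal_nondecreasing_cvgn => m n mn.
by rewrite lee_fin gm.
Qed.

Lemma stepfun_homo (a : set T -> R) m n x : (forall Q, D Q -> 0 <= a Q) ->
  (m <= n)%N -> stepfun a (F m) x <= stepfun a (F n) x.
Proof.
move=> a0 mn; have [uF FsD Fm _] := FD.
rewrite -lee_fin /stepfun -!sumEFin; apply: le_sum_subset => //.
  exact: Fm.
by move=> Q /FsD DQ; rewrite lee_fin mulr_ge0 ?a0 ?indic_ge0.
Qed.

Lemma seqmax_homo (a : set T -> R) m n x :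
  (m <= n)%N -> seqmax a (F m) x <= seqmax a (F n) x.
Proof.
move=> mn; have [_ _ Fm _] := FD.
apply: seqmax_le => [|Q Qm]; first exact: seqmax_ge0.
by apply: seqmax_ub; exact: (Fm m n).
Qed.

Lemma esum_stepfun (a : set T -> R) (e : set T -> \bar R) x :
  (forall Q, D Q -> 0 <= a Q) -> (forall Q, D Q -> e Q = (a Q)%:E) ->
  (\esum_(Q in D) e Q * (\1_Q x)%:E = nat_sup (fun n => stepfun a (F n)) x)%E.
Proof.
move=> a0 ea; have [uF FsD Fm _] := FD.
rewrite (esum_exhausts FD); last first.
  by move=> Q DQ; rewrite ea// -EFinM lee_fin mulr_ge0 ?a0 ?indic_ge0.
rewrite /nat_sup.
apply: (congr1 (fun g : nat -> \bar R => ereal_sup (range g))).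
apply/funext => n.
rewrite /stepfun -sumEFin big_seq [RHS]big_seq; apply: eq_bigr => Q /FsD DQ.
by rewrite ea.
Qed.

(** The truncation of the supremum by 0 is built into seqmax. *)
Lemma sup_seqmax (b : set T -> R) x :
  (maxe 0 (ereal_sup [set (b Q * \1_Q x)%:E | Q in D]) =
  nat_sup (fun n => seqmax b (F n)) x)%E.
Proof.
have [uF FsD Fm FE] := FD.
apply/eqP; rewrite eq_le; apply/andP; split.
  rewrite ge_max; apply/andP; split.
    by apply: nat_sup_ge0 => n; exact: seqmax_ge0.
  apply: ge_ereal_sup => _ [Q DQ <-]; have [n Qn] := FE _ DQ.
  by apply: le_trans (nat_sup_ub _ n _); rewrite lee_fin; exact: seqmax_ub.
rewrite {1}/nat_sup; apply: ge_ereal_sup => _ [n _ <-].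
rewrite /seqmax; elim: (F n) (FsD n) => [|Q s IH] sD.
  by rewrite big_nil le_max lexx.
rewrite big_cons EFin_max ge_max; apply/andP; split; last first.
  by apply: IH => P Ps; apply: sD; rewrite inE Ps orbT.
rewrite le_max; apply/orP; right; apply: ereal_sup_ubound; exists Q => //.
exact/sD/mem_head.
Qed.

End SupFormulas.

Section LnormMono.
Context d (T : measurableType d) (R : realType).
Variable mu : {measure set T -> \bar R}.

Lemma le_Lnorm_conjugate (p : R) (f g : T -> \bar R) : 1 <= p ->
  measurable_fun setT f -> measurable_fun setT g ->
  (forall x, 0 <= f x)%E -> (forall x, f x <= g x)%E ->
  ('N[mu]_(hoelder_conjugate p%:E)[f] <= 'N[mu]_(hoelder_conjugate p%:E)[g])%E.
Proof.
move=> p1 mf mg f0 fg.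
have g0 x : (0 <= g x)%E by exact: le_trans (fg x).
move: p1; rewrite le_eqVlt => /predU1P[p1|p1].
  rewrite -p1 hoelder_conjugate1 unlock; case: ifPn => // _.
  by apply: le_ess_sup; apply: nearW => x /=; rewrite !gee0_abs.
have pm1 : 0 < p - 1 by rewrite subr_gt0.
have p0 : 0 < p by rewrite (lt_trans ltr01).
rewrite hoelder_conjugate_gt1//; set r := p / (p - 1).
have r0 : 0 < r by rewrite divr_gt0.
rewrite unlock; apply: le_poweR.
- by rewrite invr_ge0 ltW.
- by apply: integral_ge0 => x _; exact: poweR_ge0.
apply: ge0_le_integral => //.
- by move=> x _; exact: poweR_ge0.
- apply: (@measurableT_comp _ _ _ _ _ _ (fun x => x `^ r)%E) => //=.
    exact: measurable_poweR.
  exact: measurableT_comp.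
- apply: (@measurableT_comp _ _ _ _ _ _ (fun x => x `^ r)%E) => //=.
    exact: measurable_poweR.
  exact: measurableT_comp.
by move=> x _; apply: le_poweR; rewrite ?(ltW r0)// !gee0_abs.
Qed.

End LnormMono.

(** * The two estimates *)

Section Main.
Context (R : realType) (d : nat) (p q : R).
Hypotheses (q0 : 0 < q) (q1 : q < 1) (p1 : 1 <= p).
Local Notation Rd := (borelRd R d).
Variables (sigma omega : {measure set Rd -> \bar R}).
Hypotheses (sigma_lf : locally_finite sigma) (omega_lf : locally_finite omega).
Variable lambda : set Rd -> R.
Local Notation D := (calQ sigma omega lambda).
Local Notation r := (q / (1 - q)).

Let p0 : 0 < p. Proof. exact: lt_le_trans ltr01 p1. Qed.
Let pn0 : p != 0. Proof. by rewrite gt_eqF. Qed.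
Let qn0 : q != 0. Proof. by rewrite gt_eqF. Qed.
Let q1' : 0 < 1 - q. Proof. by rewrite subr_gt0. Qed.
Let r0 : 0 < r. Proof. by rewrite divr_gt0. Qed.

Let calQ_measurable Q : D Q -> measurable Q.
Proof. by move=> [dQ _ _ _]; exact: measurable_dyadic. Qed.
Let calQ_sigma Q : D Q -> (0 < sigma Q < +oo)%E.
Proof. by move=> [dQ _ s0 _]; rewrite s0 dyadic_lty. Qed.
Let calQ_omega Q : D Q -> (0 < omega Q < +oo)%E.
Proof. by move=> [dQ _ _ o0]; rewrite o0 dyadic_lty. Qed.
Let calQ_lambda Q : D Q -> 0 < lambda Q.
Proof. by case. Qed.
Let calQ_nested P Q : D P -> D Q -> nested P Q.
Proof. by move=> [dP _ _ _] [dQ _ _ _]; exact: nested_dyadic. Qed.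
Let fsigma0 Q : D Q -> 0 < fine (sigma Q).
Proof. by move=> /calQ_sigma/andP[s0 soo]; rewrite fine_gt0// s0. Qed.
Let fomega0 Q : D Q -> 0 < fine (omega Q).
Proof. by move=> /calQ_omega/andP[s0 soo]; rewrite fine_gt0// s0. Qed.
Let sigmaE Q : D Q -> sigma Q = (fine (sigma Q))%:E.
Proof. by move=> /calQ_sigma/andP[s0 soo]; rewrite fineK// ge0_fin_numE. Qed.
Let omegaE Q : D Q -> omega Q = (fine (omega Q))%:E.
Proof. by move=> /calQ_omega/andP[s0 soo]; rewrite fineK// ge0_fin_numE. Qed.

Lemma calQ_exhausted : exists F : nat -> seq (set Rd), exhausts F D.
Proof.
apply: countable_exhaustion; apply: sub_countable (@countable_dyadic R d).
by apply: subset_card_le => Q [].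
Qed.

Variable F : nat -> seq (set Rd).
Hypothesis FD : exhausts F D.

Let FsD n Q : Q \in F n -> D Q.
Proof. by case: FD => _ + _ _; apply. Qed.

Let mF n : {in F n, forall Q, measurable Q}.
Proof. by move=> Q /FsD; exact: calQ_measurable. Qed.

Lemma Lfun_ge0P (f : Rd -> R) : f \in Lfun sigma p%:E -> (forall x, 0 <= f x) ->
  measurable_fun setT f /\ (\int[sigma]_x (f x `^ p)%:E < +oo)%E.
Proof.
rewrite inE => /andP[]; rewrite !inE /= => mf fin f0; split => //.
have := poweR_lty p fin; rewrite poweR_Lnorm; last exact: pn0.
by under eq_integral do rewrite /= ger0_norm//.
Qed.

Lemma Lfun_integrable_calQ (f : Rd -> R) Q : f \in Lfun sigma p%:E ->
  (forall x, 0 <= f x) -> D Q -> sigma.-integrable Q (EFin \o f).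
Proof.
move=> fL f0 DQ; have [mf fp] := Lfun_ge0P fL f0.
have mQ := calQ_measurable DQ.
apply: ge0_integrable => //.
apply: (le_lt_trans (ge0_integral_le_powR sigma p1 mf f0 mQ)).
by rewrite lte_add_pinfty//; have /andP[] := calQ_sigma DQ.
Qed.

Lemma integral_avg (f : Rd -> R) Q : f \in Lfun sigma p%:E ->
  (forall x, 0 <= f x) -> D Q ->
  (\int[sigma]_(x in Q) (f x)%:E = (avg sigma Q f * fine (sigma Q))%:E)%E.
Proof.
move=> fL f0 DQ; rewrite /avg divfK ?gt_eqF ?fsigma0// /Rintegral fineK//.
apply: integrable_fin_num; first exact: calQ_measurable.
exact: Lfun_integrable_calQ.
Qed.

Lemma TlambdaE (f : Rd -> R) x :
  f \in Lfun sigma p%:E -> (forall x, 0 <= f x) ->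
  Tlambda sigma omega lambda f x =
  nat_sup (fun n => stepfun (fun Q => lambda Q * avg sigma Q f) (F n)) x.
Proof.
move=> fL f0; rewrite /Tlambda.
rewrite (esum_stepfun FD (a := fun Q => lambda Q * avg sigma Q f))
  => [//|Q DQ|Q DQ].
  by rewrite mulr_ge0 ?avg_ge0// ltW// calQ_lambda.
rewrite integral_avg// sigmaE// inver gt_eqF ?fsigma0//= -!EFinM.
by congr (_%:E); field; rewrite gt_eqF// fsigma0.
Qed.

Lemma sum_cE (c : set Rd -> R) x : (forall Q, D Q -> 0 <= c Q) ->
  sum_c sigma omega lambda c x =
  nat_sup (fun n =>
    stepfun (fun Q => c Q * (fine (omega Q) / fine (sigma Q))) (F n)) x.
Proof.
move=> c0; rewrite /sum_c.
rewrite (esum_stepfun FD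
  (a := fun Q => c Q * (fine (omega Q) / fine (sigma Q))))
  => [//|Q DQ|Q DQ].
  by rewrite mulr_ge0 ?c0// divr_ge0// ltW ?fsigma0 ?fomega0.
by rewrite sigmaE// omegaE// inver gt_eqF ?fsigma0.
Qed.

Lemma sup_bE (b : set Rd -> R) x :
  sup_b sigma omega lambda b x = nat_sup (fun n => seqmax b (F n)) x.
Proof. exact: sup_seqmax. Qed.

Section Sufficiency.
Variables (b c : set Rd -> R).
Hypothesis bc : factorization sigma omega lambda b c.

Let b0 Q : D Q -> 0 <= b Q. Proof. by move=> /bc[]. Qed.
Let c0 Q : D Q -> 0 <= c Q. Proof. by move=> /bc[]. Qed.
Let lbc Q : D Q -> lambda Q = b Q * c Q. Proof. by move=> /bc[]. Qed.

(** Hoelder's inequality with exponents 1/(1-q) and 1/q separates the supremum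
    of the b Q 1_Q from the sum G of the c Q <f>_Q 1_Q. The integral of G against
    omega is the pairing of f with the sum of the c Q omega(Q)/sigma(Q) 1_Q
    against sigma, to which the conjugate pair p, p' applies. *)
Let finite_sufficiency (f : Rd -> R) n :
  f \in Lfun sigma p%:E -> (forall x, 0 <= f x) ->
  (\int[omega]_x
     (stepfun (fun Q => lambda Q * avg sigma Q f) (F n) x `^ q)%:E <=
   (\int[omega]_x (sup_b sigma omega lambda b x `^ r)) `^ (1 - q) *
   ('N[sigma]_(p%:E)[EFin \o f] *
    'N[sigma]_(hoelder_conjugate p%:E)[sum_c sigma omega lambda c]) `^ q)%E.
Proof.
move=> fL f0; have [mf fp] := Lfun_ge0P fL f0.
have a0 Q : D Q -> 0 <= c Q * avg sigma Q f.
  by move=> DQ; rewrite mulr_ge0 ?c0 ?avg_ge0.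
pose B := seqmax b (F n).
pose G := stepfun (fun Q => c Q * avg sigma Q f) (F n).
pose e Q := c Q * (fine (omega Q) / fine (sigma Q)).
have e0 Q : D Q -> 0 <= e Q.
  by move=> DQ; rewrite mulr_ge0 ?c0// divr_ge0// ltW ?fsigma0 ?fomega0.
pose S := stepfun e (F n).
have mB : measurable_fun setT B by apply: measurable_seqmax; exact: mF.
have mG : measurable_fun setT G by apply: measurable_stepfun; exact: mF.
have mS : measurable_fun setT S by apply: measurable_stepfun; exact: mF.
have B0 x : 0 <= B x by exact: seqmax_ge0.
have G0 x : 0 <= G x by apply: stepfun_ge0 => Q /FsD; exact: a0.
have S0 x : 0 <= S x by apply: stepfun_ge0 => Q /FsD; exact: e0.
have TBG x : stepfun (fun Q => lambda Q * avg sigma Q f) (F n) x <= B x * G x.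
  rewrite /G /stepfun big_distrr/= big_seq [leRHS]big_seq ler_sum// => Q Qn.
  have DQ := FsD Qn; rewrite (lbc DQ) indicE.
  have := seqmax_ub b x Qn; rewrite -/(B x) indicE.
  case: (_ \in _) => /=; last by rewrite !mulr0.
  rewrite !mulr1 -[b Q * c Q * _]mulrA => bB.
  by apply: ler_wpM2r => //; exact: a0.
have T0 x : 0 <= stepfun (fun Q => lambda Q * avg sigma Q f) (F n) x.
  apply: stepfun_ge0 => Q /FsD DQ.
  by rewrite mulr_ge0 ?avg_ge0// ltW// calQ_lambda.
apply: (@le_trans _ _ (\int[omega]_x ((B x * G x) `^ q)%:E)%E).
  apply: ge0_le_integral => //.
  - by move=> x _; rewrite lee_fin powR_ge0.
  - apply/measurable_EFinP/measurable_powR_comp.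
    by apply: measurable_stepfun; exact: mF.
  - by apply/measurable_EFinP/measurable_powR_comp; exact: measurable_funM.
  move=> x _; rewrite lee_fin; apply: ge0_ler_powR; rewrite ?nnegrE//.
    exact: ltW.
  by rewrite mulr_ge0.
apply: (le_trans (hoelder_lt1 omega q0 q1 mB mG B0 G0)).
have msup : measurable_fun setT (sup_b sigma omega lambda b).
  rewrite (_ : sup_b _ _ _ _ = nat_sup (fun n => seqmax b (F n))); last first.
    by apply/funext => x; rewrite sup_bE.
  apply: measurable_nat_sup => [m|m m' x].
    by apply: measurable_seqmax; exact: mF.
  exact: (seqmax_homo FD).
apply: lee_pmul; [exact: poweR_ge0|exact: poweR_ge0| |].
  apply: le_poweR; first exact: ltW.
    by apply: integral_ge0 => x _; rewrite lee_fin powR_ge0.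
  apply: ge0_le_integral => //.
  - by move=> x _; rewrite lee_fin powR_ge0.
  - by apply/measurable_EFinP/measurable_powR_comp.
  - apply: (@measurableT_comp _ _ _ _ _ _ (fun x => x `^ r)%E) => //=.
    exact: measurable_poweR.
  move=> x _; rewrite -poweR_EFin.
  apply: le_poweR; [exact: ltW|by rewrite lee_fin|].
  by rewrite sup_bE; exact: (nat_sup_ub (fun n => seqmax b (F n))).
apply: le_poweR; first exact: ltW.
  by apply: integral_ge0 => x _; rewrite lee_fin.
have -> : (\int[omega]_x (G x)%:E = \int[sigma]_x (f x * S x)%:E)%E.
  rewrite ge0_integral_mul_stepfun//; [|exact: mF|by move=> Q /FsD; exact: e0].
  transitivity (\int[omega]_x (cst 1 x * G x)%:E)%E.
    by apply: eq_integral => x _; rewrite /= mul1r.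
  rewrite ge0_integral_mul_stepfun//; [|exact: mF|by move=> Q /FsD; exact: a0].
  rewrite big_seq [RHS]big_seq; apply: eq_bigr => Q /FsD DQ.
  have -> : (\int[omega]_(x in Q) (cst (1 : R) x)%:E = omega Q)%E.
    rewrite -[RHS]mul1e; exact: (integral_cst _ (calQ_measurable DQ) 1%E).
  rewrite integral_avg// omegaE// -!EFinM /e; congr (_%:E).
  by field; rewrite gt_eqF// fsigma0.
pose C := \sum_(Q <- F n) e Q.
have SC x : 0 <= S x <= C.
  rewrite S0/= /S /stepfun /C big_seq [leRHS]big_seq ler_sum// => Q /FsD DQ.
  by rewrite indicE; case: (_ \in _); rewrite ?mulr1// mulr0 e0.
apply: (le_trans (hoelder_conj sigma p1 mf mS f0 SC)).
apply: lee_wpmul2l; first exact: Lnorm_ge0.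
have sumE : sum_c sigma omega lambda c = nat_sup (fun n => stepfun e (F n)).
  by apply/funext => x; rewrite sum_cE.
rewrite sumE; apply: le_Lnorm_conjugate => //.
- exact/measurable_EFinP.
- apply: measurable_nat_sup => [m|m m' x].
    by apply: measurable_stepfun; exact: mF.
  exact: (stepfun_homo FD).
by move=> x; exact: (nat_sup_ub (fun n => stepfun e (F n))).
Qed.

Lemma sufficiency :
  (Tlambda_norm sigma omega lambda p q <=
   factor_bound sigma omega lambda p q b c)%E.
Proof.
apply: ereal_inf_lbound; split.
  by apply: mule_ge0; [exact: poweR_ge0|exact: Lnorm_ge0].
move=> f fL f0.
have T0 x : (0 <= Tlambda sigma omega lambda f x)%E.
  rewrite TlambdaE//; apply: nat_sup_ge0 => n; apply: stepfun_ge0 => Q /FsD DQ.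
  by rewrite mulr_ge0 ?avg_ge0// ltW// calQ_lambda.
rewrite {1}unlock.
under eq_integral => x _ do rewrite (gee0_abs (T0 x)) (TlambdaE x fL f0).
apply: (@le_trans _ _
  (((\int[omega]_x (sup_b sigma omega lambda b x `^ r)) `^ (1 - q) *
    ('N[sigma]_(p%:E)[EFin \o f] *
     'N[sigma]_(hoelder_conjugate p%:E)[sum_c sigma omega lambda c]) `^ q)
       `^ q^-1)%E).
  apply: le_poweR.
  - by rewrite invr_ge0 ltW.
  - by apply: integral_ge0 => x _; exact: poweR_ge0.
  apply: integral_sup_powR => //.
  - by move=> n; apply: measurable_stepfun; exact: mF.
  - move=> n x; apply: stepfun_ge0 => Q /FsD DQ.
    by rewrite mulr_ge0 ?avg_ge0// ltW// calQ_lambda.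
  - move=> m n x; apply: (stepfun_homo FD) => Q DQ.
    by rewrite mulr_ge0 ?avg_ge0// ltW// calQ_lambda.
  - by move=> n; exact: finite_sufficiency.
rewrite poweRM ?poweR_ge0// poweRK//; last first.
  by apply: mule_ge0; exact: Lnorm_ge0.
rewrite -poweRrM /factor_bound -muleA.
by rewrite [in leRHS](muleC 'N[sigma]_(_)[sum_c _ _ _ _]).
Qed.

End Sufficiency.

(** The admissible constants in the definition of the operator norm. *)
Definition bounded_by (C : \bar R) : Prop := (0 <= C)%E /\
  forall f : Rd -> R, f \in Lfun sigma p%:E -> (forall x, 0 <= f x) ->
  ('N[omega]_(q%:E)[Tlambda sigma omega lambda f] <=
    C * 'N[sigma]_(p%:E)[EFin \o f])%E.

Lemma ball_Lp_Lfun (h : Rd -> R) : ball_Lp sigma p h ->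
  h \in Lfun sigma p%:E /\ ('N[sigma]_(p%:E)[EFin \o h] <= 1)%E.
Proof.
move=> [mh h0 h1].
have N1 : ('N[sigma]_(p%:E)[EFin \o h] <= 1)%E.
  rewrite unlock; under eq_integral do rewrite /= ger0_norm//.
  rewrite -[leRHS](poweR1r p^-1); apply: le_poweR => //.
  - by rewrite invr_ge0 ltW.
  - by apply: integral_ge0 => x _; rewrite lee_fin powR_ge0.
split => //; rewrite inE; apply/andP; split; rewrite inE//=.
exact: le_lt_trans N1 (ltry 1).
Qed.

Let coef_ge0 (h : Rd -> R) : (forall x, 0 <= h x) ->
  forall Q, D Q -> 0 <= lambda Q * avg sigma Q h.
Proof. by move=> h0 Q DQ; rewrite mulr_ge0 ?avg_ge0// ltW// calQ_lambda. Qed.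

Let Tstep (h : Rd -> R) n := stepfun (fun Q => lambda Q * avg sigma Q h) (F n).

Let measurable_Tstep h n : measurable_fun setT (Tstep h n).
Proof. by apply: measurable_stepfun; exact: mF. Qed.

Lemma Tstep_le (h : Rd -> R) n :
  h \in Lfun sigma p%:E -> (forall x, 0 <= h x) ->
  (\int[omega]_x (Tstep h n x `^ q)%:E <=
   'N[omega]_(q%:E)[Tlambda sigma omega lambda h] `^ q)%E.
Proof.
move=> hL h0.
have hT x : Tlambda sigma omega lambda h x = nat_sup (Tstep h) x.
  exact: TlambdaE.
have T0 x : (0 <= Tlambda sigma omega lambda h x)%E.
  rewrite hT; apply: nat_sup_ge0 => m; apply: stepfun_ge0 => Q /FsD.
  exact: coef_ge0.
rewrite poweR_Lnorm; last exact: qn0.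
under [leRHS]eq_integral => x _ do rewrite (gee0_abs (T0 x)).
apply: ge0_le_integral => //.
- by move=> x _; rewrite lee_fin powR_ge0.
- by apply/measurable_EFinP/measurable_powR_comp; exact: measurable_Tstep.
- apply: (@measurableT_comp _ _ _ _ _ _ (fun x => x `^ q)%E) => //=.
    exact: measurable_poweR.
  rewrite (_ : Tlambda _ _ _ _ = nat_sup (Tstep h)); last exact/funext.
  apply: measurable_nat_sup => [m|m m' x]; first exact: measurable_Tstep.
  by apply: (stepfun_homo FD); exact: coef_ge0.
move=> x _; rewrite -poweR_EFin hT; apply: le_poweR; first exact: ltW.
  by rewrite lee_fin; apply: stepfun_ge0 => Q /FsD; exact: coef_ge0.
exact: (nat_sup_ub (Tstep h)).
Qed.

Lemma Tstep_bound (C : \bar R) (N : R) n h : bounded_by C -> (C <= N%:E)%E ->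
  ball_Lp sigma p h -> (\int[omega]_x (Tstep h n x `^ q)%:E <= (N `^ q)%:E)%E.
Proof.
move=> [C0 Cb] CN hb; have [hL h1] := ball_Lp_Lfun hb; have [_ h0 _] := hb.
apply: (le_trans (Tstep_le n hL h0)).
rewrite -poweR_EFin; apply: le_poweR; [exact: ltW|exact: Lnorm_ge0|].
apply: (le_trans (Cb h hL h0)); rewrite -[leRHS]mule1.
by apply: lee_pmul => //; exact: Lnorm_ge0.
Qed.

(** Testing the norm inequality on the indicator of one cube bounds every
    admissible constant from below. *)
Lemma calQ_empty :
  (forall e : R, 0 < e -> exists2 C, bounded_by C & (C < e%:E)%E) -> D = set0.
Proof.
move=> small; rewrite -subset0 => Q DQ.
have [_ _ _ FE] := FD; have [n Qn] := FE _ DQ.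
have mQ := calQ_measurable DQ.
have /andP[s0 soo] := calQ_sigma DQ.
have [k k0 hb] := ball_Lp_indic p1 mQ soo.
pose h x := k * \1_Q x : R.
have avgh : avg sigma Q h = k by apply: avg_indic => //; rewrite s0.
have h0 x : 0 <= h x by rewrite mulr_ge0 ?indic_ge0// ltW.
pose l := lambda Q * k.
have l0 : 0 < l by rewrite mulr_gt0// calQ_lambda.
have lower (C : \bar R) (N : R) : bounded_by C -> (C <= N%:E)%E ->
    l `^ q * fine (omega Q) <= N `^ q.
  move=> Cb CN; rewrite -lee_fin; apply: le_trans (Tstep_bound n Cb CN hb).
  rewrite EFinM -omegaE//; apply: chebyshev_powR => //; do ?[exact: ltW].
  - by move=> x; apply: stepfun_ge0 => P /FsD; exact: coef_ge0.
  move=> x Qx.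
  have := stepfun_ge (a := fun P => lambda P * avg sigma P h)
    (fun P Pn => coef_ge0 h0 (FsD Pn)) Qn Qx.
  by rewrite /= avgh.
pose e := l `^ q * fine (omega Q).
have e0 : 0 < e by rewrite mulr_gt0 ?powR_gt0// fomega0.
have e20 : 0 < (e / 2) `^ q^-1 by rewrite powR_gt0// divr_gt0.
have [C Cb Ce] := small _ e20.
have := lower C _ Cb (ltW Ce).
rewrite -powRrM mulVf// powRr1 ?divr_ge0 ?(ltW e0)// -/e; lra.
Qed.

(** The factorizations of the restrictions of the operator to the finite
    families F n; L is to be N^q for an admissible constant N. *)
Definition finite_stage (L : R) (n : nat) (bn : set Rd -> R) : Prop :=
  [/\ {in F n, forall Q, 0 < bn Q},
      (\int[omega]_x (seqmax bn (F n) x `^ r)%:E <= (4 * L)%:E)%E &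
      forall h, ball_Lp sigma p h ->
        \sum_(Q <- F n) lambda Q / bn Q * fine (omega Q) * avg sigma Q h
          <= 12 * L].

Lemma finite_stage_ex (C : \bar R) (N : R) n : bounded_by C -> (C <= N%:E)%E ->
  0 < N -> exists bn, finite_stage (N `^ q) n bn.
Proof.
move=> Cb CN N0; have L0 : 0 < N `^ q by exact: powR_gt0.
apply: finite_factorization => //.
- by move=> Q /FsD; exact: calQ_sigma.
- by move=> Q /FsD; exact: calQ_omega.
- by move=> P Q /FsD DP /FsD DQ; exact: calQ_nested.
- by move=> Q /FsD; exact: calQ_lambda.
- by move=> h hb; exact: Tstep_bound Cb CN hb.
Qed.

Lemma finite_stage_term_ge0 L n bn h Q : finite_stage L n bn ->
  (forall x, 0 <= h x) -> Q \in F n ->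
  0 <= lambda Q / bn Q * fine (omega Q) * avg sigma Q h.
Proof.
move=> [bn0 _ _] h0 Qn; have DQ := FsD Qn.
apply: mulr_ge0; last exact: avg_ge0.
apply: mulr_ge0; last exact: fine_ge0.
by apply: divr_ge0; apply: ltW; [exact: calQ_lambda|exact: bn0].
Qed.

(** Each of the two estimates of a finite stage, read on a single cube, bounds
    bn Q on one side: the first one from above, the second one, tested on the
    indicator of Q, from below. *)
Lemma finite_stage_bounds L (bn : nat -> set Rd -> R) (k : set Rd -> R) :
  0 < L ->
  (forall n, finite_stage L n (bn n)) ->
  (forall Q, D Q -> 0 < k Q /\ ball_Lp sigma p (fun x => k Q * \1_Q x)) ->
  forall Q, D Q -> \forall n \near \oo,
    lambda Q * fine (omega Q) * k Q / (12 * L) <= bn n Q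
      <= (4 * L / fine (omega Q)) `^ r^-1.
Proof.
move=> L0 bnP kP Q DQ.
have [_ _ Fm FE] := FD; have [m Qm] := FE _ DQ.
exists m => // n /= mn; have Qn := Fm _ _ mn _ Qm.
have [bn0 bn1 bn2] := bnP n; have b0 := bn0 _ Qn.
have o0 := fomega0 DQ; have l0 := calQ_lambda DQ.
have [k0 kb] := kP Q DQ.
have mQ := calQ_measurable DQ.
apply/andP; split.
  have kx x : 0 <= k Q * \1_Q x by rewrite mulr_ge0 ?indic_ge0// ltW.
  have := bn2 _ kb; rewrite (big_rem Q)//= avg_indic//; last exact: calQ_sigma.
  rewrite ler_pdivrMr ?mulr_gt0// => hle.
  have rem0 : 0 <= \sum_(P <- rem Q (F n)) lambda P / bn n P * fine (omega P) *
      avg sigma P (fun x => k Q * \1_Q x).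
    rewrite big_seq sumr_ge0// => P /mem_rem Pn.
    exact: (finite_stage_term_ge0 (bnP n) kx Pn).
  have {hle rem0} : lambda Q / bn n Q * fine (omega Q) * k Q <= 12 * L by lra.
  rewrite (_ : lambda Q / bn n Q * fine (omega Q) * k Q =
    lambda Q * fine (omega Q) * k Q / bn n Q); last by field; rewrite gt_eqF.
  by rewrite ler_pdivrMr// [bn n Q * _]mulrC.
have h1 : bn n Q `^ r * fine (omega Q) <= 4 * L.
  rewrite -lee_fin; apply: le_trans bn1; rewrite EFinM -omegaE//.
  apply: chebyshev_powR => //; do ?[exact: ltW].
  - by apply: measurable_seqmax; exact: mF.
  - by move=> x; exact: seqmax_ge0.
  move=> x Qx; have := seqmax_ub (bn n) x Qn.
  by rewrite indicE mem_set// mulr1.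
have -> : bn n Q = (bn n Q `^ r) `^ r^-1.
  by rewrite -powRrM mulfV ?gt_eqF// powRr1// ltW.
apply: ge0_ler_powR; rewrite ?nnegrE ?powR_ge0 ?invr_ge0 ?(ltW r0)//.
  by rewrite divr_ge0 ?mulr_ge0 ?(ltW L0) ?(ltW o0).
by rewrite ler_pdivlMr.
Qed.

Section Selection.
Variables (L : R) (b : set Rd -> R) (bn : nat -> set Rd -> R).
Hypotheses (L0 : 0 < L) (b0 : forall Q, D Q -> 0 < b Q).
Hypothesis bnP : forall n, finite_stage L n (bn n).
Hypothesis select : forall m, exists2 n, (m <= n)%N &
  forall Q, Q \in F m -> b Q <= 2 * bn n Q /\ bn n Q <= 2 * b Q.

Let c Q := lambda Q / b Q.

Let c0 Q : D Q -> 0 <= c Q.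
Proof. by move=> DQ; rewrite divr_ge0// ltW ?b0// calQ_lambda. Qed.

Lemma selected_sup_b :
  (\int[omega]_x (sup_b sigma omega lambda b x `^ r) <=
   (2 `^ r * (4 * L))%:E)%E.
Proof.
under eq_integral => x _ do rewrite sup_bE.
apply: integral_sup_powR => //.
- by move=> m; apply: measurable_seqmax; exact: mF.
- by move=> m x; exact: seqmax_ge0.
- by move=> m n x; exact: (seqmax_homo FD).
move=> m; have [n mn sel] := select m; have [_ bn1 _] := bnP n.
have [_ _ Fm _] := FD.
have mbn : measurable_fun setT (fun x => seqmax (bn n) (F n) x `^ r).
  by apply: measurable_powR_comp; apply: measurable_seqmax; exact: mF.
apply: (@le_trans _ _ ((2 `^ r)%:E *
    \int[omega]_x (seqmax (bn n) (F n) x `^ r)%:E)%E); last first.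
  by rewrite [leRHS]EFinM; apply: lee_wpmul2l => //; rewrite lee_fin powR_ge0.
rewrite -ge0_integralZl_EFin ?powR_ge0//; do ?[exact/measurable_EFinP
  |by move=> x _; rewrite lee_fin powR_ge0].
apply: ge0_le_integral => //.
- by move=> x _; rewrite lee_fin powR_ge0.
- apply/measurable_EFinP/measurable_powR_comp.
  by apply: measurable_seqmax; exact: mF.
- by apply/measurable_EFinP; exact: measurable_funM.
move=> x _; rewrite -EFinM lee_fin -powRM// ?seqmax_ge0//.
apply: ge0_ler_powR;
  rewrite ?nnegrE ?seqmax_ge0 ?(ltW r0) ?mulr_ge0 ?seqmax_ge0//.
apply: seqmax_le => [|Q Qm]; first by rewrite mulr_ge0 ?seqmax_ge0.
have [bb _] := sel _ Qm.
have := seqmax_ub (bn n) x (Fm _ _ mn _ Qm); rewrite !indicE.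
have := seqmax_ge0 (bn n) (F n) x.
by case: (_ \in _); rewrite /= ?mulr1 ?mulr0; lra.
Qed.

Lemma selected_sum_c :
  ('N[sigma]_(hoelder_conjugate p%:E)[sum_c sigma omega lambda c] <=
   (24 * L)%:E)%E.
Proof.
pose e Q := c Q * (fine (omega Q) / fine (sigma Q)).
have e0 Q : D Q -> 0 <= e Q.
  by move=> DQ; rewrite mulr_ge0 ?c0// divr_ge0// ltW ?fsigma0 ?fomega0.
have K0 : 0 < 24 * L by rewrite mulr_gt0.
rewrite (_ : sum_c _ _ _ _ = nat_sup (fun n => stepfun e (F n))); last first.
  by apply/funext => x; rewrite sum_cE.
have S0 m x : 0 <= stepfun e (F m) x by apply: stepfun_ge0 => Q /FsD; exact: e0.
have mS m : measurable_fun setT (stepfun e (F m)).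
  by apply: measurable_stepfun; exact: mF.
apply: Lnorm_sup => //; first exact: ltW.
  by move=> m n x; exact: (stepfun_homo FD).
move=> m; apply: (@Lnorm_duality _ _ _ _ _ _ (seq_cover (F m))
  (\sum_(Q <- F m) e Q)) => //.
- by apply: measurable_seq_cover; exact: mF.
- apply: seq_cover_lty; first exact: mF.
  by move=> Q /FsD/calQ_sigma/andP[].
- move=> x; have [xm|xm] := pselect (seq_cover (F m) x); last first.
    rewrite [X in _ <= _ * X]indicE memNset// mulr0 /stepfun.
    rewrite big_seq big1// => Q Qm.
    rewrite indicE memNset ?mulr0// => Qx; apply: xm.
    by apply/seq_coverP; exists Q.
  rewrite [X in _ <= _ * X]indicE mem_set// mulr1 /stepfun.
  rewrite big_seq [leRHS]big_seq ler_sum// => Q /FsD DQ.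
  by rewrite indicE; case: (_ \in _); rewrite ?mulr1// mulr0 e0.
move=> h hb; have [mh h0 _] := hb; have [hL _] := ball_Lp_Lfun hb.
rewrite ge0_integral_mul_stepfun//; do ?[exact: mF|by move=> Q /FsD; exact: e0].
have [n mn sel] := select m; have [bn0 _ bn2] := bnP n.
have [uF _ Fm _] := FD.
rewrite (_ : \sum_(Q <- F m) _ = (\sum_(Q <- F m)
   lambda Q / b Q * fine (omega Q) * avg sigma Q h)%:E)%E; last first.
  rewrite -sumEFin big_seq [RHS]big_seq; apply: eq_bigr => Q /FsD DQ.
  rewrite integral_avg// -EFinM /e /c; congr (_%:E).
  by field; rewrite !gt_eqF ?b0 ?fsigma0.
rewrite lee_fin.
have -> : 24 * L = 2 * (12 * L) by lra.
apply: (@le_trans _ _ (2 * \sum_(Q <- F m)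
   lambda Q / bn n Q * fine (omega Q) * avg sigma Q h)).
  rewrite big_distrr/= big_seq [leRHS]big_seq ler_sum// => Q Qm.
  have DQ := FsD Qm; have [_ bb] := sel _ Qm.
  have := avg_ge0 sigma Q h0; move: (avg sigma Q h) => A A0.
  rewrite !mulrA; apply: ler_wpM2r => //.
  apply: ler_wpM2r; first exact: fine_ge0.
  have bQ := b0 DQ; have bnQ := bn0 _ (Fm _ _ mn _ Qm).
  rewrite ler_pdivrMr// mulrAC ler_pdivlMr//.
  have := calQ_lambda DQ; nra.
apply: ler_wpM2l => //; apply: le_trans (bn2 _ hb).
rewrite -lee_fin -!sumEFin; apply: le_sum_subset => //.
  exact: (Fm m n).
by move=> Q Qn; rewrite lee_fin; exact: (finite_stage_term_ge0 (bnP n) h0 Qn).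
Qed.

End Selection.

(** The factors b^(n) of the finite stages are bounded above and below on each
    cube, so they accumulate at some b > 0 which, on each finite family F m, is
    within a factor 2 of some b^(n) with n >= m. The estimates of the n-th stage
    pass to F m with a loss of this factor, and monotone convergence in m
    removes the restriction to finite families. *)
Lemma necessity_bounded (C : \bar R) (N : R) :
  bounded_by C -> (C <= N%:E)%E -> 0 < N ->
  exists b c : set Rd -> R, factorization sigma omega lambda b c /\
    (factor_bound sigma omega lambda p q b c <=
     (48 * 4 `^ ((1 - q) / q) * N)%:E)%E.
Proof.
move=> Cb CN N0.
pose L := N `^ q.
have L0 : 0 < L by exact: powR_gt0.
have [bn bnP] := choice (fun n => finite_stage_ex n Cb CN N0).
have exlo Q : exists k : R,
    D Q -> 0 < k /\ ball_Lp sigma p (fun x => k * \1_Q x).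
  have [DQ|nDQ] := pselect (D Q); last by exists 0.
  have /andP[_ soo] := calQ_sigma DQ.
  by have [k k0 kb] := ball_Lp_indic p1 (calQ_measurable DQ) soo; exists k.
have [k kP] := choice exlo.
have lo0 Q : D Q -> 0 < lambda Q * fine (omega Q) * k Q / (12 * L).
  move=> DQ; have [k0 _] := kP Q DQ.
  by rewrite divr_gt0 ?mulr_gt0 ?calQ_lambda ?fomega0.
have [b b0 bsel] :=
  ultrafilter_selection lo0 (finite_stage_bounds L0 bnP kP).
have select m := bsel (F m) m (@FsD m).
exists b, (fun Q => lambda Q / b Q); split.
  move=> Q DQ; split; [exact/ltW/b0| |].
    by rewrite divr_ge0// ltW ?b0// calQ_lambda.
  by rewrite mulrC divfK// gt_eqF// b0.
rewrite /factor_bound.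
apply: (@le_trans _ _
  (((2 `^ r * (4 * L))%:E `^ ((1 - q) / q)) * (24 * L)%:E)%E).
  apply: lee_pmul; [exact: poweR_ge0|exact: Lnorm_ge0| |].
    apply: le_poweR; first by rewrite divr_ge0// ltW.
      by apply: integral_ge0 => x _; exact: poweR_ge0.
    exact: (selected_sup_b bnP select).
  exact: (selected_sum_c L0 b0 bnP select).
(* with r = q / (1 - q): (2^r)^(1/r) = 2 and L^(1/r) L = N^(1-q) N^q = N *)
rewrite poweR_EFin -EFinM lee_fin.
rewrite !powRM ?powR_ge0 ?mulr_ge0 ?(ltW L0)// -[(2 `^ _) `^ _]powRrM.
have -> : r * ((1 - q) / q) = 1 by field; rewrite !gt_eqF.
rewrite powRr1// /L -powRrM.
have -> : q * ((1 - q) / q) = 1 - q by field.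
have -> : N `^ (1 - q) = N / N `^ q.
  by rewrite powRB ?(gt_eqF N0) ?implybT// powRr1// ltW.
rewrite le_eqVlt; apply/orP; left; apply/eqP.
by field; rewrite gt_eqF// powR_gt0.
Qed.

(** An admissible constant below twice the norm will do when the norm is
    positive and finite. For an infinite norm every factorization serves; a norm
    equal to 0 leaves no cubes. *)
Lemma necessity : exists b c : set Rd -> R,
  factorization sigma omega lambda b c /\
  (factor_bound sigma omega lambda p q b c <=
   (96 * 4 `^ ((1 - q) / q))%:E * Tlambda_norm sigma omega lambda p q)%E.
Proof.
set A := 4 `^ ((1 - q) / q).
have A0 : 0 < A by exact: powR_gt0.
have normE : Tlambda_norm sigma omega lambda p q = ereal_inf bounded_by by [].
have norm_ge0 : (0 <= Tlambda_norm sigma omega lambda p q)%E.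
  by rewrite normE; apply: le_ereal_inf_tmp => C [].
have [normy|normfin] := eqVneq (Tlambda_norm sigma omega lambda p q) +oo%E.
  exists lambda, (cst 1); split.
    by move=> Q /calQ_lambda l0; split; rewrite ?mulr1// ltW.
  by rewrite normy gt0_muley ?leey// lte_fin mulr_gt0.
have normR : Tlambda_norm sigma omega lambda p q \is a fin_num.
  by rewrite ge0_fin_numE// ltey.
pose N := fine (Tlambda_norm sigma omega lambda p q).
have NE : Tlambda_norm sigma omega lambda p q = N%:E by rewrite fineK.
have near (e : R) : 0 < e -> exists2 C, bounded_by C & (C < (N + e)%:E)%E.
  move=> e0; rewrite EFinD -NE normE.
  by apply: lb_ereal_inf_adherent => //; rewrite -normE.
have [N0|N0] := eqVneq N 0.
  have D0 : D = set0.
    by apply: calQ_empty => e e0; have := near e e0; rewrite N0 add0r.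
  exists lambda, (cst 1); split; first by rewrite /factorization D0 => Q.
  rewrite NE N0 mule0 /factor_bound.
  rewrite (_ : (fun x => sup_b _ _ _ _ x `^ _)%E = cst 0%E).
    by rewrite integral0 poweR0r ?mul0e// gt_eqF// divr_gt0.
  apply/funext => x; rewrite /sup_b D0 image_set0 ereal_sup0.
  by rewrite max_l ?leNye// poweR0r// gt_eqF.
have Npos : 0 < N by rewrite lt_neqAle eq_sym N0 -lee_fin -NE.
have [C Cb CN] := near N Npos.
have [b [c [bc bd]]] := necessity_bounded Cb (ltW CN) (addr_gt0 Npos Npos).
exists b, c; split => //; apply: (le_trans bd).
rewrite NE -EFinM lee_fin -/A; lra.
Qed.


End Main.

Theorem theorem1p2 (R : realType) (p q : R)
    (q_gt0 : 0 < q) (q_lt1 : q < 1) (p_ge1 : 1 <= p) :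
  exists C C' : R, [/\ 0 < C, 0 < C' &
    forall (d : nat) (d_gt0 : (0 < d)%N)
      (sigma omega : {measure set (borelRd R d) -> \bar R})
      (sigma_lf : locally_finite sigma) (omega_lf : locally_finite omega)
      (lambda : set (borelRd R d) -> R)
      (lambda_ge0 : forall Q, dyadic Q -> 0 <= lambda Q),
    (forall b c : set (borelRd R d) -> R,
       factorization sigma omega lambda b c ->
       (Tlambda_norm sigma omega lambda p q
          <= C%:E * factor_bound sigma omega lambda p q b c)%E)
    /\
    (exists b c : set (borelRd R d) -> R,
       factorization sigma omega lambda b c /\
       (factor_bound sigma omega lambda p q b c
          <= C'%:E * Tlambda_norm sigma omega lambda p q)%E)].
Proof.
exists 1, (96 * 4 `^ ((1 - q) / q)).
split; [by []|by rewrite mulr_gt0// powR_gt0|].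
move=> d _ sigma omega slf olf lambda _.
have [F FD] := calQ_exhausted sigma omega lambda.
split=> [b c bc|].
  by rewrite mul1e; exact: (sufficiency q_gt0 q_lt1 p_ge1 slf olf FD bc).
exact: (necessity q_gt0 q_lt1 p_ge1 slf olf FD).
Qed.
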